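(* Let $\varphi\in C^1(\mathbb{R}^2)$ be compactly supported with $\operatorname{supp}(\varphi)\subseteq[N_1,M_1]\times[N_2,M_2]$ and $\widehat{\varphi}(\boldsymbol{0})\neq0$, with $\{\varphi(\cdot-\boldsymbol{k}):\boldsymbol{k}\in\mathbb{Z}^2\}$ linearly independent, and let $f\in V(\varphi,\mathbb{Z}^2)$ be a target function with $\operatorname{supp}(f)\subseteq[a_1,b_1]\times[a_2,b_2]$. Let $$E=\big([\lceil a_1-M_1\rceil,\lfloor b_1-N_1\rfloor]\times[\lceil a_2-M_2\rceil,\lfloor b_2-N_2\rfloor]\big)\cap\mathbb{Z}^2=\{\boldsymbol{k}_1,\dots,\boldsymbol{k}_{\#E}\},$$ and let $E^+=\emptyset$ if $\#E=1$ and $E^+=\{\boldsymbol{x}-\boldsymbol{y}:\boldsymbol{x}\neq\boldsymbol{y}\in E\}$ if $\#E>1$. Choose a direction vector $\boldsymbol{p}\in\{(\cos\theta,\sin\theta):\theta\in[0,2\pi)\}\setminus\mathrm{dv}_{\mathcal{N}_{E^+}}$ and put $$L_{\boldsymbol{p},1}=-\sqrt2\max\{|N_i|,|M_i|:i=1,2\}+\min\{\boldsymbol{p}\boldsymbol{k}:\boldsymbol{k}\in E\},$$ $$L_{\boldsymbol{p},2}=\sqrt2\max\{|N_i|,|M_i|:i=1,2\}+\max\{\boldsymbol{p}\boldsymbol{k}:\boldsymbol{k}\in E\},$$ $$\delta_{\boldsymbol{p}}=\sqrt{\frac{\lambda_{\min}(G_{\varphi,\boldsymbol{p}})}{3\,\#E\,(L_{\boldsymbol{p},2}-L_{\boldsymbol{p},1})}}\Big/\Big(2(\|\varphi_1\|_\infty+\|\varphi_2\|_\infty)\max\{|N_i|,|M_i|:i=1,2\}\Big),\qquad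 K_{\boldsymbol{p}}=\Big\lceil\frac{L_{\boldsymbol{p},2}-L_{\boldsymbol{p},1}}{\delta_{\boldsymbol{p}}}\Big\rceil,$$ where $\lambda_{\min}(G_{\varphi,\boldsymbol{p}})$ is the minimum eigenvalue of the Gram matrix $$G_{\varphi,\boldsymbol{p}}=\Big(\int_{\mathbb{R}}\mathcal{R}_{\boldsymbol{p}}\varphi(x-\boldsymbol{p}\boldsymbol{k}_j)\,\overline{\mathcal{R}_{\boldsymbol{p}}\varphi(x-\boldsymbol{p}\boldsymbol{k}_n)}\,dx\Big)_{j,n=1}^{\#E},$$ $\varphi_1,\varphi_2$ are the partial derivatives of $\varphi(x_1,x_2)$ with respect to $x_1$ and $x_2$, and $\|\varphi_i\|_\infty=\max_{(x_1,x_2)\in[N_1,M_1]\times[N_2,M_2]}|\varphi_i(x_1,x_2)|$. Let $$Y_{\boldsymbol{p}}=\Big\{x_k=L_{\boldsymbol{p},1}+\frac{L_{\boldsymbol{p},2}-L_{\boldsymbol{p},1}}{K_{\boldsymbol{p}}}(k-1):k=1,\dots,K_{\boldsymbol{p}}+1\Big\}.$$ Then there exists $X_{\boldsymbol{p}}=\{x_{i_1},\dots,x_{i_{\#E}}\}\subseteq Y_{\boldsymbol{p}}$ such that the $\#E\times\#E$ matrix $A_{\varphi,\boldsymbol{p},X_{\boldsymbol{p}}}=\big(\mathcal{R}_{\boldsymbol{p}}\varphi(x_{i_j}-\boldsymbol{p}\boldsymbol{k}_n)\big)_{j,n=1}^{\#E}$ is invertible, and consequently $f$ can be determined uniquely by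 its single-angle Radon samples (with respect to $\boldsymbol{p}$) at $X_{\boldsymbol{p}}$.
   Context: Vectors in $\mathbb{R}^2$ are columns; a direction vector $\boldsymbol{p}=(\cos\theta,\sin\theta)$ is a row vector, so $\boldsymbol{p}\boldsymbol{k}=k_1\cos\theta+k_2\sin\theta$. $\mathcal{R}_{\boldsymbol{p}}f(t)=\int_{-\infty}^{\infty}f(t\cos\theta-s\sin\theta,\,t\sin\theta+s\cos\theta)\,ds$. The Fourier transform is $\widehat{g}(\gamma)=\int_{\mathbb{R}^d}g(\boldsymbol{x})e^{-i\boldsymbol{x}\cdot\gamma}d\boldsymbol{x}$. $V(\varphi,\mathbb{Z}^2)=\{\sum_{\boldsymbol{k}\in\mathbb{Z}^2}c_{\boldsymbol{k}}\varphi(\cdot-\boldsymbol{k}):\sum_{\boldsymbol{k}}|c_{\boldsymbol{k}}|^2<\infty\}$. The set $E$ is understood to be nonempty. For $\mathcal{S}\subseteq\mathbb{R}^2$ with $\mathcal{S}\setminus\{\boldsymbol{0}\}\ne\emptyset$: the direction vector set is $\mathrm{dv}_{\mathcal{S}}=\{(\cos\theta,\sin\theta):\ \boldsymbol{0}\neq\boldsymbol{x}=\|\boldsymbol{x}\|_2(\cos\theta,\sin\theta)^T\in\mathcal{S}\}$, and the null set is $\mathcal{N}_{\mathcal{S}}=\{\boldsymbol{0}\ne\boldsymbol{y}\in\mathbb{R}^2:\text{there is }\boldsymbol{0}\neq\boldsymbol{x}\in\mathcal{S}\text{ with }\boldsymbol{x}^T\boldsymbol{y}=0\}$. For $\mathcal{S}=\emptyset$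 or $\{\boldsymbol{0}\}$, both sets are defined to be $\emptyset$. Standing convention: a target function $f\in V(\varphi,\mathbb{Z}^2)$ with $\operatorname{supp}(f)\subseteq[a_1,b_1]\times[a_2,b_2]$ is one expressed as $f=\sum_{\boldsymbol{k}\in E}c_{\boldsymbol{k}}\varphi(\cdot-\boldsymbol{k})$ with $c_{\boldsymbol{k}}\in\mathbb{C}$. ''$f$ can be determined uniquely by its single-angle Radon samples at $X$'' means that $f$ is the only function $h$ of the form $\sum_{\boldsymbol{k}\in E}d_{\boldsymbol{k}}\varphi(\cdot-\boldsymbol{k})$, $d_{\boldsymbol{k}}\in\mathbb{C}$, with $\mathcal{R}_{\boldsymbol{p}}h(x)=\mathcal{R}_{\boldsymbol{p}}f(x)$ for all $x\in X$. *)

(* Defs.v *)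
From HB Require Import structures.
From mathcomp Require Import all_boot all_order all_algebra.
From mathcomp Require Import all_classical all_reals all_analysis.
From mathcomp Require Export complex.
Set Implicit Arguments.
Unset Strict Implicit.
Unset Printing Implicit Defensive.
Import Order.TTheory GRing.Theory Num.Theory.
Import numFieldNormedType.Exports.
Local Open Scope classical_set_scope.
Local Open Scope ring_scope.
Local Open Scope complex_scope.

Section Plane.
Variable R : realType.
Implicit Types (x y p : R * R) (k : int * int) (S : set (R * R)).

Definition int_point k : R * R := (k.1%:~R, k.2%:~R).

Definition dot2 x y : R := x.1 * y.1 + x.2 * y.2.

Definition norm2 x : R := Num.sqrt (x.1 ^+ 2 + x.2 ^+ 2).

Definition box (a1 b1 a2 b2 : R) : set (R * R) := `[a1, b1] `*` `[a2, b2].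

Definition directions : set (R * R) :=
  [set p | exists2 theta : R, 0 <= theta < 2 * pi & p = (cos theta, sin theta)].

(* Empty when S is included in {0}, so the special case in the usual definition
   needs no clause of its own; the same holds for [null_vectors]. *)
Definition direction_vectors S : set (R * R) :=
  [set p | exists theta : R, p = (cos theta, sin theta) /\
     exists x, [/\ S x, x != 0 & x = norm2 x *: (cos theta, sin theta)]].

Definition null_vectors S : set (R * R) :=
  [set y | y != 0 /\ exists x, [/\ S x, x != 0 & dot2 x y = 0]].

Definition index_set (a1 b1 a2 b2 N1 M1 N2 M2 : R) : set (int * int) :=
  [set k | (Num.ceil (a1 - M1) <= k.1 <= Num.floor (b1 - N1)) /\
           (Num.ceil (a2 - M2) <= k.2 <= Num.floor (b2 - N2))].

(* E^+; it is empty when E is a singleton. *)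
Definition differences (E : set (int * int)) : set (R * R) :=
  [set z | exists k l, [/\ E k, E l, k != l & z = int_point k - int_point l]].

End Plane.

Section ComplexFunctions.
Variable R : realType.

Definition Cintegral d (T : measurableType d) (mu : {measure set T -> \bar R})
    (D : set T) (g : T -> R[i]) : R[i] :=
  Rintegral mu D (fun x => complex.Re (g x)) +i* Rintegral mu D (fun x => complex.Im (g x)).

Implicit Types (g phi f h : R * R -> R[i]) (p v : R * R) (E : set (int * int)).

Definition supp g : set (R * R) := closure [set x | g x != 0].

Definition fourier2 g (gamma : R * R) : R[i] :=
  Cintegral (lebesgue_measure \x lebesgue_measure)%E [set: R * R]
    (fun x => g x * (cos (dot2 x gamma) -i* sin (dot2 x gamma))).

Definition radon p g (t : R) : R[i] :=
  Cintegral lebesgue_measure [set: R]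
    (fun s => g (t * p.1 - s * p.2, t * p.2 + s * p.1)).

Definition C1_real (u : R * R -> R) : Prop :=
  forall v, v \in [:: (1, 0); (0, 1)] ->
    (forall x, derivable u x v) /\ continuous ('D_v u).

Definition C1_complex g : Prop :=
  C1_real (fun x => complex.Re (g x)) /\ C1_real (fun x => complex.Im (g x)).

Definition Cderive v g (x : R * R) : R[i] :=
  'D_v (fun y => complex.Re (g y)) x +i* 'D_v (fun y => complex.Im (g y)) x.

(* For continuous g and nonempty compact D this supremum is a maximum. *)
Definition sup_norm (D : set (R * R)) g : R :=
  sup [set ComplexField.Normc.normc (g x) | x in D].

Definition translate phi (k : int * int) (x : R * R) : R[i] := phi (x - int_point R k).

(* The sums over Z^2 below have pointwise finitely many nonzero terms: phi is
   compactly supported wherever they are used. *)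
Definition shift_space phi : set (R * R -> R[i]) :=
  [set f | exists c : int * int -> R[i],
     (\esum_(k in [set: int * int])
        ((ComplexField.Normc.normc (c k)) ^+ 2)%:E < +oo)%E /\
     forall x, f x = \sum_(k \in [set: int * int]) c k * translate phi k x].

Definition shift_span phi E : set (R * R -> R[i]) :=
  [set f | exists c : int * int -> R[i],
     forall x, f x = \sum_(k \in E) c k * translate phi k x].

Definition shifts_linearly_independent phi : Prop :=
  forall c : int * int -> R[i], finite_set [set k | c k != 0] ->
    (forall x, \sum_(k \in [set: int * int]) c k * translate phi k x = 0) ->
    forall k, c k = 0.

Definition determined_by_radon phi E p (X : set R) f : Prop :=
  shift_span phi E f /\
  forall h, shift_span phi E h ->
    (forall x, X x -> radon p h x = radon p f x) -> h = f.

End ComplexFunctions.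

(* Meant for Hermitian G, all of whose eigenvalues are real; for n > 0 the
   infimum is then over a nonempty finite set, i.e. a minimum. *)
Definition lambda_min (R : realType) n (G : 'M[R[i]]_n) : R :=
  inf [set r : R | eigenvalue G r%:C].

Section Sampling.
Variables (R : realType) (phi : R * R -> R[i]) (N1 M1 N2 M2 : R).
Variables (p : R * R) (E : set (int * int)).
Variables (n : nat) (k : 'I_n -> int * int).

Definition max_bound : R :=
  Num.max (Num.max `|N1| `|M1|) (Num.max `|N2| `|M2|).

(* E is finite and nonempty in use, so [inf] and [sup] are [min] and [max]. *)
Definition L_lower : R :=
  - Num.sqrt 2 * max_bound + inf [set dot2 p (int_point R e) | e in E].

Definition L_upper : R :=
  Num.sqrt 2 * max_bound + sup [set dot2 p (int_point R e) | e in E].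

Definition gram : 'M[R[i]]_n :=
  \matrix_(j, m) Cintegral lebesgue_measure [set: R] (fun x =>
    radon p phi (x - dot2 p (int_point R (k j))) *
    (radon p phi (x - dot2 p (int_point R (k m))))^*).

Definition delta : R :=
  Num.sqrt (lambda_min gram / (3 * n%:R * (L_upper - L_lower))) /
  (2 * (sup_norm (box N1 M1 N2 M2) (Cderive (1, 0) phi) +
        sup_norm (box N1 M1 N2 M2) (Cderive (0, 1) phi)) * max_bound).

Definition grid_size : int := Num.ceil ((L_upper - L_lower) / delta).

Definition sample_grid : set R :=
  [set L_lower + (L_upper - L_lower) / grid_size%:~R * (i - 1)%:~R | i in [set i : int | 1 <= i <= grid_size + 1]].

Definition sample_matrix (x : 'I_n -> R) : 'M[R[i]]_n :=
  \matrix_(j, m) radon p phi (x j - dot2 p (int_point R (k m))).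

End Sampling.

(* Main.v *)
Require Import Defs.
From mathcomp Require Import all_boot all_order all_algebra.
From mathcomp Require Import all_classical all_reals all_analysis.
From mathcomp Require Import measurable_realfun sesquilinear spectral ring lra.
Set Implicit Arguments.
Unset Strict Implicit.
Unset Printing Implicit Defensive.
Import Order.TTheory GRing.Theory Num.Theory.
Import numFieldNormedType.Exports.
Local Open Scope classical_set_scope.
Local Open Scope ring_scope.
Local Open Scope complex_scope.

(* Write g for the Radon transform of phi in the direction p, M for the bound
   [max_bound] and S for the sum of the sup norms of the partial derivatives of
   phi.  Then g is supported in [-sqrt 2 M, sqrt 2 M] and, by the mean value
   inequality on the lines orthogonal to p, is Lipschitz with constant
   2 sqrt 2 M S.  It is not identically zero: otherwise Fubini and a shear would
   give phi^(0) = 0.  The choice of p makes the numbers p k, k in E, distinct, so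
   the shifts g(. - p k) are linearly independent (look near the right end of the
   support of the rightmost shift) and their Gram matrix is positive definite.
   If F = sum_k c_k g(. - p k) vanishes on the grid, whose step is at most delta,
   then |F| <= 2 sqrt 2 M S delta sum |c_k| on [L1, L2], whence
   lambda_min |c|^2 <= int |F|^2 <= (2/3) lambda_min |c|^2 and c = 0.  So the
   matrix of the g(x_i - p k) over the whole grid has full column rank, and an
   invertible square submatrix can be extracted. *)

Local Notation normc := ComplexField.Normc.normc.

(** * Measurability and integration on the line and the plane *)

Section Measurability.
Variable R : realType.
Notation mu := (@lebesgue_measure R).

(** An open set is the union of the countably many squares with rational centre and radius that it
    contains, and each such square is a product of intervals. *)
Lemma open_measurable_plane (A : set (R * R)) : open A -> measurable A.
Proof.
move=> oA.
pose B (q : rat * rat * rat) : set (R * R) :=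
  ball (ratr q.1.1 : R) (ratr q.2) `*` ball (ratr q.1.2 : R) (ratr q.2).
have -> : A = \bigcup_q (if `[< B q `<=` A >] then B q else set0).
  apply/seteqP; split => [x Ax|x [q _]]; last first.
    by case: ifPn => // /asboolP + Bx; exact.
  have /nbhs_ballP[e /= e0 eA] : nbhs x A by exact: open_nbhs_nbhs.
  (* A centre within [e / 4] of [x] and a radius between [e / 4] and [e / 2] give a square that
     contains [x] and stays within [e] of it. *)
  have e4 (y : R) : y - e / 4 < y + e / 4 by lra.
  have [q1] := rat_in_itvoo (e4 x.1); rewrite in_itv /= => /andP[a1 b1].
  have [q2] := rat_in_itvoo (e4 x.2); rewrite in_itv /= => /andP[a2 b2].
  have er : e / 4 < e / 2 by lra.
  have [r] := rat_in_itvoo er; rewrite in_itv /= => /andP[a3 b3].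
  exists ((q1, q2), r) => //; case: ifPn => [_|/asboolP []]; last first.
    move=> y [/= y1 y2]; apply: eA; split => /=;
      move: y1 y2; rewrite -!ball_normE /= !ltr_norml => /andP[? ?] /andP[? ?];
      apply/andP; split; lra.
  by split; rewrite /= -ball_normE /= ltr_norml; apply/andP; split; lra.
apply: countable_bigcupT_measurable => [|q]; first exact: countableP.
by case: ifPn => // _; apply: measurableX; rewrite ball_itv; exact: measurable_itv.
Qed.

Lemma continuous_measurable_plane (u : R * R -> R) :
  continuous u -> measurable_fun setT u.
Proof.
move=> /continuousP cu; apply: (measurability _ (RGenOpens.measurableE R)).
move=> _ [_ [a [b ->] <-]]; rewrite setTI; apply: open_measurable_plane.
exact/cu/interval_open.
Qed.

Lemma affine_measurable (a b : R) :
  measurable_fun setT (fun x : measurableTypeR R => a * x + b : measurableTypeR R).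
Proof. by apply: measurable_funD => //; apply: measurable_funM. Qed.

(** As a function of [A] the right-hand side is a scaled pushforward measure. It agrees with [mu] on
    half-open intervals, whose ends are exchanged when [a < 0], and uniqueness of Lebesgue measure
    does the rest. *)
Lemma lebesgue_measure_affine (a b : R) (A : set R) : a != 0 -> measurable A ->
  (mu A = `|a|%:E * mu ((fun x => a * x + b)%R @^-1` A))%E.
Proof.
move=> a0 mA.
pose P : {measure set (measurableTypeR R) -> \bar R} :=
  measure_function_pushforward__canonical__measure_function_Measure mu
    (affine_measurable a b).
have := @lebesgue_measure_unique R (mscale (NngNum (normr_ge0 a)) P).
apply => // _ [[c d] _ <-] /=.
rewrite /mscale /P /= /pushforward.
have [a_gt0|a_lt0] : 0 < a \/ a < 0 by case: (ltgtP a 0) a0 => //; [right|left].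
- rewrite (_ : _ @^-1` _ = `](c - b) / a, (d - b) / a]%classic); last first.
    apply/seteqP; split => x /=; rewrite !in_itv /= ltr_pdivrMr// ler_pdivlMr//;
      move=> /andP[? ?]; apply/andP; split; nra.
  rewrite !lebesgue_measure_itv /= !lte_fin ltr_pM2r ?invr_gt0// ltrD2r.
  case: ifPn; rewrite ?mule0// => _; rewrite -!EFinB -EFinM gtr0_norm//.
  by congr EFin; field; rewrite gt_eqF.
- rewrite (_ : _ @^-1` _ = `[(d - b) / a, (c - b) / a[%classic); last first.
    apply/seteqP; split => x /=; rewrite !in_itv /= ltr_ndivlMr// ler_ndivrMr//;
      move=> /andP[? ?]; apply/andP; split; nra.
  rewrite !lebesgue_measure_itv /= !lte_fin ltr_nM2r ?invr_lt0// ltrD2r.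
  case: ifPn; rewrite ?mule0// => _; rewrite -!EFinB -EFinM ltr0_norm//.
  by congr EFin; field; rewrite lt_eqF.
Qed.

Lemma ge0_integral_affine (f : R -> \bar R) (a b : R) : a != 0 ->
  measurable_fun setT f -> (forall x, 0 <= f x)%E ->
  (\int[mu]_x f x = `|a|%:E * \int[mu]_x f (a * x + b)%R)%E.
Proof.
move=> a0 mf f0.
pose P : {measure set (measurableTypeR R) -> \bar R} :=
  measure_function_pushforward__canonical__measure_function_Measure mu
    (affine_measurable a b).
rewrite (eq_measure_integral (mscale (NngNum (normr_ge0 a)) P)); last first.
  by move=> A mA _; exact: lebesgue_measure_affine.
rewrite ge0_integral_mscale//; congr (_ * _)%E.
by rewrite ge0_integral_pushforward//; exact: affine_measurable.
Qed.

(** Positive and negative parts are substituted separately. Integrability of the substituted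
    function makes both integrals finite, so the factor distributes over their difference. *)
Lemma integral_affine (f : R -> R) (a b : R) : a != 0 ->
  measurable_fun setT f ->
  mu.-integrable setT (EFin \o (fun x => f (a * x + b))) ->
  \int[mu]_x f x = `|a| * \int[mu]_x f (a * x + b).
Proof.
move=> a0 mf intf.
have mEf : measurable_fun setT (EFin \o f) by exact/measurable_EFinP.
pose F := (EFin \o (fun x => f (a * x + b))).
have fp := integrable_fin_num measurableT (integrable_funepos measurableT intf).
have fn := integrable_fin_num measurableT (integrable_funeneg measurableT intf).
have PE : (\int[mu]_x (EFin \o f)^\+ x = `|a|%:E * \int[mu]_x F^\+ x)%E.
  rewrite (ge0_integral_affine b a0 (measurable_funepos mEf))//.
  by congr (_ * _)%E; apply: eq_integral => x _; rewrite !unlock.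
have NE : (\int[mu]_x (EFin \o f)^\- x = `|a|%:E * \int[mu]_x F^\- x)%E.
  rewrite (ge0_integral_affine b a0 (measurable_funeneg mEf))//.
  by congr (_ * _)%E; apply: eq_integral => x _; rewrite !unlock.
transitivity (fine (`|a|%:E * (\int[mu]_x F^\+ x - \int[mu]_x F^\- x))%E).
  congr fine; rewrite muleBr// ?fin_num_adde_defr// integralE.
  by congr (_ - _)%E; [exact: PE | exact: NE].
rewrite fineM//; last by rewrite fin_numB; apply/andP; split; [exact: fp | exact: fn].
by congr (_ * fine _); rewrite [RHS]integralE.
Qed.

Lemma integrable_csupp (f : R -> R) (r : R) : continuous f ->
  (forall x, r < `|x| -> f x = 0) -> mu.-integrable setT (EFin \o f).
Proof.
move=> cf f0.
have : mu.-integrable `[- r, r] (EFin \o f).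
  apply: (@continuous_compact_integrable R f); first exact: segment_compact.
  exact: continuous_subspaceT.
have mI : measurable (`[- r, r] : set (measurableTypeR R)) by exact: measurable_itv.
move=> /(integrable_mkcond (mu := mu) (EFin \o f) mI).1; apply: eq_integrable => // x _.
rewrite patchE; case: ifPn => //= /negP.
rewrite inE /= in_itv /= => xr; rewrite f0//.
by rewrite ltNge; apply/negP; rewrite ler_norml.
Qed.

(** By continuity [f] exceeds [f x0 / 2] on a ball around [x0], so a multiple of the indicator of
    that ball bounds the integral from below. *)
Lemma integral_gt0_continuous (f : R -> R) (r x0 : R) : continuous f ->
  (forall x, r < `|x| -> f x = 0) -> (forall x, 0 <= f x) ->
  f x0 != 0 -> 0 < \int[mu]_x f x.
Proof.
move=> cf f0 fge0 fx0.
have fx0_gt0 : 0 < f x0 by rewrite lt_neqAle eq_sym fx0 fge0.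
have /nbhs_ballP[e /= e_gt0 fe] : \forall x \near x0, f x0 / 2 < f x.
  by apply: (cvgr_gt (f x0) (cf x0)); lra.
have mI : measurable (ball x0 e) by rewrite ball_itv; exact: measurable_itv.
have intI : mu.-integrable setT (EFin \o \1_(ball x0 e)).
  by rewrite ball_itv; exact: integrable_indic_itv.
have intJ : \int[mu]_x \1_(ball x0 e) x = 2 * e.
  rewrite /Rintegral integral_indic// setIT ball_itv.
  rewrite [X in fine X]lebesgue_measure_itv /= lte_fin ifT /=; last by lra.
  by ring.
apply: (@lt_le_trans _ _ (f x0 / 2 * (2 * e))).
  by rewrite !mulr_gt0.
rewrite -intJ -RintegralZl//; apply: le_Rintegral => //.
- apply: eq_integrable (integrableZl measurableT (f x0 / 2) intI) => // x _.
- exact: integrable_csupp f0.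
- move=> x _; rewrite indicE; case: (boolP (x \in _)) => [|_].
    by rewrite inE mulr1 => /fe/ltW.
  by rewrite mulr0.
Qed.

End Measurability.

(** * Fubini and shears in the plane *)

Section Plane.
Variable R : realType.
Notation mu := (@lebesgue_measure R).

(** A square rather than a disc, so that horizontal and vertical slices inherit the same radius. *)
Definition vanishes_off (r : R) (w : R * R -> R) :=
  forall x, (r < `|x.1|) || (r < `|x.2|) -> w x = 0.

Lemma continuous_pair (T : topologicalType) (f g : T -> R) :
  continuous f -> continuous g -> continuous (fun t => (f t, g t) : R * R).
Proof. by move=> cf cg t; exact: (cvg_pair (cf t) (cg t)). Qed.

Lemma integrable_plane (w : R * R -> R) (r : R) : continuous w ->
  vanishes_off r w -> (mu \x mu)%E.-integrable setT (EFin \o w).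
Proof.
move=> cw w0.
pose I : set (measurableTypeR R) := `[- r, r]%classic.
have mI : measurable I by exact: measurable_itv.
have cI : compact (I : set R) by exact: segment_compact.
have cII : compact (`[- r, r]%classic `*` `[- r, r]%classic : set (R * R)).
  exact: compact_setX.
have mII : measurable (I `*` I) by exact: measurableX.
have : (mu \x mu)%E.-integrable (I `*` I) (EFin \o w).
  apply: measurable_bounded_integrable => //.
  - rewrite [ltLHS](product_measure1E mu mu mI mI) lte_mul_pinfty//.
    + rewrite ge0_fin_numE//; exact: compact_finite_measure.
    + exact: compact_finite_measure.
  - apply: measurable_funTS; exact: continuous_measurable_plane.
  - have /compact_bounded : compact (w @` (`[- r, r]%classic `*` `[- r, r]%classic)).
      by apply: continuous_compact => //; exact: continuous_subspaceT.
    move=> [B [Br BP]]; exists B; split => // x Bx y Iy /=.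
    by apply: BP Bx _ _; exists y.
move=> /(integrable_mkcond (mu := (mu \x mu)%E) (EFin \o w) mII).1.
apply: eq_integrable => // x _.
rewrite patchE; case: ifPn => //=; rewrite notin_setE => xI; rewrite w0//.
apply: contrapT => /negP; rewrite negb_or -!leNgt => /andP[x1 x2]; apply: xI.
by split; rewrite /I /= in_itv /= -ler_norml.
Qed.

Lemma continuous_comp_pair (T : topologicalType) (w : R * R -> R) (f g : T -> R) :
  continuous w -> continuous f -> continuous g -> continuous (fun t => w (f t, g t)).
Proof.
move=> cw cf cg t.
apply: (@cvg_comp _ _ _ (fun t => (f t, g t)) w _ (nbhs (f t, g t))).
  exact: continuous_pair.
exact: cw.
Qed.

Lemma continuous_affine (a b : R) : continuous (fun t : R => a * t + b).
Proof.
by move=> t; apply: cvgD; [apply: cvgM; [exact: cvg_cst|exact: cvg_id]|exact: cvg_cst].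
Qed.

Lemma integrable_slice2 (w : R * R -> R) (r x : R) : continuous w ->
  vanishes_off r w -> mu.-integrable setT (EFin \o (fun y => w (x, y))).
Proof.
move=> cw w0; apply: (integrable_csupp (r := r)).
  by apply: continuous_comp_pair => // t; [exact: cvg_cst|exact: cvg_id].
by move=> y ry; apply: w0; rewrite ry orbT.
Qed.

Lemma integrable_slice1 (w : R * R -> R) (r y : R) : continuous w ->
  vanishes_off r w -> mu.-integrable setT (EFin \o (fun x => w (x, y))).
Proof.
move=> cw w0; apply: (integrable_csupp (r := r)).
  by apply: continuous_comp_pair => // t; [exact: cvg_id|exact: cvg_cst].
by move=> x rx; apply: w0; rewrite rx.
Qed.

Lemma plane_fubini1 (w : R * R -> R) (r : R) : continuous w -> vanishes_off r w ->
  Rintegral (mu \x mu)%E setT w = \int[mu]_x \int[mu]_y w (x, y).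
Proof.
move=> cw w0; have iw := integrable_plane cw w0.
rewrite /Rintegral -(integral12_prod_meas1 iw) /fubini_F; congr fine.
apply: eq_integral => x _; rewrite fineK//.
exact: (integrable_fin_num measurableT (integrable_slice2 x cw w0)).
Qed.

Lemma plane_fubini2 (w : R * R -> R) (r : R) : continuous w -> vanishes_off r w ->
  Rintegral (mu \x mu)%E setT w = \int[mu]_y \int[mu]_x w (x, y).
Proof.
move=> cw w0; have iw := integrable_plane cw w0.
rewrite /Rintegral -(integral21_prod_meas1 iw) /fubini_G; congr fine.
apply: eq_integral => y _; rewrite fineK//.
exact: (integrable_fin_num measurableT (integrable_slice1 y cw w0)).
Qed.

Lemma Rintegral0 d (S : measurableType d) (m : {measure set S -> \bar R}) :
  \int[m]_x (0 : R) = 0.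
Proof. by rewrite /Rintegral integral0_eq. Qed.

(* For [c != 0] the substitution [y = t * sigma + s * c] turns the line
   integrals of [w] into those of the sheared function [v], and integrating out
   the other variable first undoes the shear. *)
Lemma plane_integral_eq0 (w : R * R -> R) (r c sigma : R) : continuous w ->
  vanishes_off r w -> c ^+ 2 + sigma ^+ 2 = 1 ->
  (forall t, \int[mu]_s w (t * c - s * sigma, t * sigma + s * c) = 0) ->
  Rintegral (mu \x mu)%E setT w = 0.
Proof.
move=> cw w0 cs W0.
have [c0|c0] := eqVneq c 0.
  (* For [c = 0] the lines are horizontal: the inner integral at height [y] is [|sigma|] times the
     line integral at [t = y / sigma]. *)
  rewrite (plane_fubini2 cw w0).
  have s0 : sigma != 0 by apply/eqP => s0; move: cs; rewrite c0 s0; lra.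
  rewrite -[RHS](Rintegral0 mu); apply: eq_Rintegral => y _.
  rewrite (@integral_affine _ _ (- sigma) 0) ?oppr_eq0//.
  - rewrite -[RHS](mulr0 `|- sigma|) -[X in _ = _ * X](W0 (y / sigma)); congr (_ * _).
    apply: eq_Rintegral => x _; congr w; congr pair; rewrite c0; first ring.
    by field.
  - apply: continuous_measurable_fun; apply: continuous_comp_pair => // t;
      [exact: cvg_id|exact: cvg_cst].
  - apply: (integrable_csupp (r := r / `|sigma|)).
      apply: (@continuous_comp_pair _ w (fun x => - sigma * x + 0) (cst y)) => //.
      - exact: continuous_affine.
      - by move=> t; exact: cvg_cst.
    move=> x rx; apply: w0; rewrite /= addr0 normrM normrN.
    by rewrite mulrC -ltr_pdivrMr ?normr_gt0// rx.
(* Solving [y = t * sigma + s * c] for [s] turns [t * c - s * sigma] into [(t - y * sigma) / c],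
   because [c ^+ 2 + sigma ^+ 2 = 1]. *)
pose v (z : R * R) := w ((z.1 - z.2 * sigma) / c, z.2).
have cv : continuous v.
  apply: continuous_comp_pair => // z; last exact: cvg_snd.
  apply: cvgM; last exact: cvg_cst.
  by apply: cvgB; [exact: cvg_fst | apply: cvgM; [exact: cvg_snd|exact: cvg_cst]].
have c_gt0 : 0 < `|c| by rewrite normr_gt0.
(* Outside this radius either [|z.2| > r], or [|z.2| <= r] and [|z.1 - z.2 * sigma| >= |z.1| - r *
   |sigma| > r * |c|]; in both cases [w] vanishes. *)
pose r' := `|r| * (`|c| + `|sigma| + 1).
have v0 : vanishes_off r' v.
  move=> z zr; apply: w0 => /=.
  rewrite normrM normfV ltr_pdivlMr//.
  have [z2|z2] := ltP r `|z.2|; rewrite ?orbT// orbF.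
  have r_ge0 : 0 <= r by apply: le_trans z2.
  have : r' < `|z.1|.
    case/orP : zr => // zr; exfalso; move: zr; apply/negP; rewrite -leNgt.
    rewrite (le_trans z2)// /r' ger0_norm// ler_peMr//.
    by rewrite lerDr addr_ge0.
  rewrite /r' (ger0_norm r_ge0) => z1.
  have := lerB_normD z.1 (- (z.2 * sigma)); rewrite normrN normrM => h.
  have h2 : `|z.2| * `|sigma| <= r * `|sigma| by exact: ler_wpM2r.
  nra.
have V0 t : \int[mu]_y v (t, y) = 0.
  have cs' : 1 - sigma ^+ 2 = c ^+ 2 by rewrite -cs addrK.
  rewrite (@integral_affine _ _ c (t * sigma)) //.
  - rewrite -[RHS](mulr0 `|c|) -[X in _ = _ * X](W0 t); congr (_ * _).
    apply: eq_Rintegral => s _; rewrite /v /=; congr w; congr pair; last by ring.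
    rewrite (_ : _ - _ = t * (1 - sigma ^+ 2) - c * s * sigma); last by ring.
    by rewrite cs'; field.
  - apply: continuous_measurable_fun; apply: continuous_comp_pair => // x;
      [exact: cvg_cst|exact: cvg_id].
  - apply: (integrable_csupp (r := (r' + `|t * sigma|) / `|c|)).
      apply: (@continuous_comp_pair _ v (cst t) (fun x => c * x + t * sigma)) => //.
      - by move=> x; exact: cvg_cst.
      - exact: continuous_affine.
    move=> x; rewrite ltr_pdivrMr// => rx; apply: v0; apply/orP; right => /=.
    have := lerB_normD (c * x) (t * sigma); rewrite normrM => h.
    lra.
(* The factor [|c^-1|] comes from the substitution in the horizontal variable, so [v'] and [w] have
   the same integral over each horizontal line. *)
pose v' (z : R * R) := `|c^-1| * v z.
have cv' : continuous v' by move=> z; apply: cvgM; [exact: cvg_cst|exact: cv].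
have v0' : vanishes_off r' v' by move=> z zr; rewrite /v' v0// mulr0.
have : Rintegral (mu \x mu)%E setT v' = 0.
  rewrite (plane_fubini1 cv' v0') -[RHS](Rintegral0 mu).
  apply: eq_Rintegral => x _.
  by rewrite RintegralZl//; [rewrite V0 mulr0|exact: integrable_slice2 v0].
rewrite (plane_fubini2 cw w0) (plane_fubini2 cv' v0') => <-.
apply: eq_Rintegral => y _.
rewrite (@integral_affine _ _ c^-1 (- y * sigma / c)) ?invr_eq0//.
- rewrite RintegralZl//; last exact: integrable_slice1 v0.
  by congr (_ * _); apply: eq_Rintegral => x _; rewrite /v /=; congr w; congr pair; ring.
- apply: continuous_measurable_fun; apply: continuous_comp_pair => // x;
    [exact: cvg_id|exact: cvg_cst].
- apply: eq_integrable (integrable_slice1 y cv v0) => // x _ /=.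
  by rewrite /v /=; congr (w _)%:E; congr pair; ring.
Qed.

End Plane.

(** * Line integrals of real functions *)

Section RealRadon.
Variable R : realType.
Notation mu := (@lebesgue_measure R).

(** One constant per coordinate, to be filled by bounds of the two partial derivatives. *)
Definition separately_lipschitz (S1 S2 : R) (w : R * R -> R) :=
  forall x y, `|w x - w y| <= S1 * `|x.1 - y.1| + S2 * `|x.2 - y.2|.

Lemma separately_lipschitz_continuous (S1 S2 : R) (w : R * R -> R) :
  separately_lipschitz S1 S2 w -> continuous w.
Proof.
move=> lw x; apply/cvgrPdist_le => e e0.
pose S := `|S1| + `|S2| + 1.
have S_gt0 : 0 < S by rewrite /S ltr_wpDl// addr_ge0.
have eS : 0 < e / S by rewrite divr_gt0.
have : nbhs x (ball x (e / S)) by apply/nbhs_ballP; exists (e / S).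
apply: filterS => y [/=]; rewrite -!ball_normE /= => h1 h2.
apply: le_trans (lw x y) _.
apply: (@le_trans _ _ (`|S1| * (e / S) + `|S2| * (e / S))).
  have le2 (a b c : R) : `|b| < c -> a * `|b| <= `|a| * c.
    move=> bc; apply: (@le_trans _ _ (`|a| * `|b|)).
      by rewrite ler_wpM2r// ler_norm.
    by rewrite ler_wpM2l// ltW.
  by apply: lerD; exact: le2.
rewrite -mulrDl mulrCA ler_piMr ?(ltW e0)// ler_pdivrMr// mul1r /S; lra.
Qed.

Definition real_radon (p : R * R) (w : R * R -> R) (t : R) : R :=
  \int[mu]_s w (t * p.1 - s * p.2, t * p.2 + s * p.1).

Variables (p : R * R) (w : R * R -> R) (M : R).
Hypotheses (p_unit : p.1 ^+ 2 + p.2 ^+ 2 = 1) (w0 : vanishes_off M w).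

Let rotation_norm t s :
  (t * p.1 - s * p.2) ^+ 2 + (t * p.2 + s * p.1) ^+ 2 = t ^+ 2 + s ^+ 2.
Proof.
by rewrite -[RHS]mulr1 -p_unit; ring.
Qed.

(** The rotation preserves the Euclidean norm, and the square of half-side [M] lies in the disc of
    radius [sqrt 2 * M]. *)
Lemma vanishes_off_rotation t s :
  (Num.sqrt 2 * M < `|t|) || (Num.sqrt 2 * M < `|s|) ->
  w (t * p.1 - s * p.2, t * p.2 + s * p.1) = 0.
Proof.
move=> h; apply: w0 => /=; apply: contrapT => /negP.
rewrite negb_or -!leNgt => /andP[h1 h2].
have M0 : 0 <= M by apply: le_trans h1.
have sq (a b : R) : `|a| <= b -> a ^+ 2 <= b ^+ 2.
  by move=> ab; rewrite -[a ^+ 2]real_normK ?num_real// lerXn2r ?nnegrE// (le_trans _ ab).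
have : (Num.sqrt 2 * M) ^+ 2 < t ^+ 2 + s ^+ 2.
  have sq' (a : R) : Num.sqrt 2 * M < `|a| -> (Num.sqrt 2 * M) ^+ 2 < a ^+ 2.
    move=> ab; rewrite -[a ^+ 2]real_normK ?num_real// ltrXn2r ?nnegrE//.
    by rewrite mulr_ge0 ?sqrtr_ge0.
  case/orP : h => /sq' h.
    by rewrite (lt_le_trans h)// lerDl sqr_ge0.
  by rewrite (lt_le_trans h)// lerDr sqr_ge0.
rewrite -rotation_norm exprMn sqr_sqrtr// => h'.
have := sq _ _ h1; have := sq _ _ h2; lra.
Qed.

Lemma real_radon_integrable t : continuous w ->
  mu.-integrable setT (EFin \o (fun s => w (t * p.1 - s * p.2, t * p.2 + s * p.1))).
Proof.
move=> cw; apply: (integrable_csupp (r := Num.sqrt 2 * M)); last first.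
  by move=> s sM; apply: vanishes_off_rotation; rewrite sM orbT.
apply: continuous_comp_pair => // s.
- by apply: cvgB; [exact: cvg_cst|apply: cvgM; [exact: cvg_id|exact: cvg_cst]].
- by apply: cvgD; [exact: cvg_cst|apply: cvgM; [exact: cvg_id|exact: cvg_cst]].
Qed.

Lemma real_radon_supp t : Num.sqrt 2 * M < `|t| -> real_radon p w t = 0.
Proof.
move=> tM; rewrite /real_radon -[RHS](Rintegral0 mu); apply: eq_Rintegral => s _.
by apply: vanishes_off_rotation; rewrite tM.
Qed.

(** The two integrands differ by at most [(S1 + S2) * |t - t'|], since [|p.1|] and [|p.2|] are at
    most 1, and both vanish off an interval of length [2 * sqrt 2 * M]. *)
Lemma real_radon_lipschitz (S1 S2 : R) t t' : 0 <= M -> 0 <= S1 -> 0 <= S2 ->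
  separately_lipschitz S1 S2 w ->
  `|real_radon p w t - real_radon p w t'| <=
    2 * Num.sqrt 2 * M * (S1 + S2) * `|t - t'|.
Proof.
move=> M0 S10 S20 lw.
have cw := separately_lipschitz_continuous lw.
have it := real_radon_integrable t cw.
have it' := real_radon_integrable t' cw.
have r0 : 0 <= Num.sqrt 2 * M by rewrite mulr_ge0 ?sqrtr_ge0.
rewrite /real_radon -RintegralB//.
apply: le_trans (le_normr_Rintegral _ _) _ => //; first exact: integrableB it it'.
pose I : set (measurableTypeR R) := `[- (Num.sqrt 2 * M), Num.sqrt 2 * M]%classic.
have iI : mu.-integrable setT (EFin \o \1_I) by exact: integrable_indic_itv.
have mI : measurable I by exact: measurable_itv.
pose B := (S1 + S2) * `|t - t'|.
have -> : 2 * Num.sqrt 2 * M * (S1 + S2) * `|t - t'| = \int[mu]_s (B * \1_I s).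
  rewrite RintegralZl// /Rintegral integral_indic// setIT.
  rewrite [X in fine X]lebesgue_measure_itv /= lte_fin /B.
  case: ifPn => /=; first by move=> _; ring.
  (* The interval degenerates to a point only when [sqrt 2 * M = 0]; then both sides are 0. *)
  rewrite -leNgt => r_le.
  rewrite mulr0 (_ : 2 * Num.sqrt 2 * M = 2 * (Num.sqrt 2 * M)); last by ring.
  have -> : Num.sqrt 2 * M = 0 by lra.
  by rewrite mulr0 !mul0r.
apply: le_Rintegral => //.
- exact/integrable_norm/(integrableB measurableT it it').
- exact: eq_integrable (integrableZl measurableT B iI).
move=> s _ /=; rewrite indicE; case: (boolP (s \in I)) => [_|sI].
  rewrite mulr1; apply: le_trans (lw _ _) _ => /=.
  have p1 : `|p.1| <= 1.
    by rewrite -(ler_pXn2r (n := 2))// ?nnegrE// real_normK ?num_real// expr1n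
      -p_unit lerDl sqr_ge0.
  have p2 : `|p.2| <= 1.
    by rewrite -(ler_pXn2r (n := 2))// ?nnegrE// real_normK ?num_real// expr1n
      -p_unit lerDr sqr_ge0.
  rewrite (_ : _ - _ = (t - t') * p.1); last by ring.
  rewrite (_ : _ + _ - _ = (t - t') * p.2); last by ring.
  by rewrite !normrM /B mulrDl; apply: lerD; apply: ler_wpM2l => //; rewrite ler_piMr.
rewrite mulr0.
have sM : Num.sqrt 2 * M < `|s|.
  move: sI; rewrite notin_setE /I /= in_itv /= => /negP.
  by rewrite -ler_norml -ltNge.
by rewrite !vanishes_off_rotation ?sM ?orbT// subrr normr0.
Qed.

End RealRadon.

(** * Mean value estimates for phi *)

Section Modulus.
Variable R : realType.
Implicit Types (z : R[i]) (a b : R).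

Lemma normcE z : normc z = Num.sqrt (complex.Re z ^+ 2 + complex.Im z ^+ 2).
Proof. by case: z. Qed.

Lemma sqr_normcE z : normc z ^+ 2 = complex.Re z ^+ 2 + complex.Im z ^+ 2.
Proof. by rewrite normcE sqr_sqrtr// addr_ge0 ?sqr_ge0. Qed.

Lemma normc_ge0 z : 0 <= normc z.
Proof. by rewrite normcE sqrtr_ge0. Qed.

(** Cauchy-Schwarz in the plane; the difference of the squares is itself a square by Lagrange's
    identity. *)
Lemma normc_direction_le a b z : a ^+ 2 + b ^+ 2 = 1 ->
  `|a * complex.Re z + b * complex.Im z| <= normc z.
Proof.
move=> ab; rewrite -(ler_pXn2r (n := 2))// ?nnegrE ?normc_ge0//.
rewrite real_normK ?num_real// sqr_normcE.
rewrite -[leRHS]mul1r -ab -subr_ge0.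
rewrite (_ : _ - _ = (a * complex.Im z - b * complex.Re z) ^+ 2) ?sqr_ge0//.
by ring.
Qed.

(** The unit vector is [z] divided by its modulus, or [(1, 0)] when [z = 0]. Writing the modulus as
    a real linear form reduces estimates for complex functions to real ones, where the mean value
    theorem is available. *)
Lemma normc_direction z :
  exists a b, a ^+ 2 + b ^+ 2 = 1 /\ a * complex.Re z + b * complex.Im z = normc z.
Proof.
have [z0|z0] := eqVneq (normc z) 0.
  exists 1, 0; split; first by rewrite expr1n expr0n addr0.
  by move: z0 => /ComplexField.Normc.eq0_normc ->; rewrite /= expr0n /= addr0 sqrtr0 !mulr0 addr0.
exists (complex.Re z / normc z), (complex.Im z / normc z); split.
  by rewrite !expr_div_n -mulrDl -sqr_normcE divff// expf_neq0.
rewrite mulrAC [X in _ + X]mulrAC -mulrDl -!expr2 -sqr_normcE expr2.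
by rewrite mulfK.
Qed.

End Modulus.

Section MeanValue.
Variable R : realType.
Implicit Types (w : R * R -> R) (phi : R * R -> R[i]).

Lemma derivable_slice (w : R * R -> R) (v x : R * R) (t : R) :
  derivable w (x + t *: v) v ->
  is_derive t (1 : R) (fun s : R => w (x + s *: v)) ('D_v w (x + t *: v)).
Proof.
move=> dw.
have E : (fun h : R =>
     h^-1 *: (((fun s : R => w (x + s *: v)) \o shift t) (h *: 1) - w (x + t *: v)))
   = (fun h : R => h^-1 *: ((w \o shift (x + t *: v)) (h *: v) - w (x + t *: v))).
  apply/funext => h /=; congr (_ *: (w _ - _)).
  by rewrite /shift /= [h *: 1]mulr1 scalerDl addrCA.
split; first by rewrite /derivable /= E.
by rewrite /derive E.
Qed.

Lemma directional_lipschitz (w : R * R -> R) (v x : R * R) (S t : R) :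
  (forall y, derivable w y v) -> (forall y, `|'D_v w y| <= S) ->
  `|w (x + t *: v) - w x| <= S * `|t|.
Proof.
move=> dw bw.
pose f s := w (x + s *: v).
have df s : is_derive s (1 : R) f ('D_v w (x + s *: v)) by exact: derivable_slice.
have cf : continuous f.
  by move=> s; apply/differentiable_continuous/derivable1_diffP; have [] := df s.
have key a b : a <= b -> `|f b - f a| <= S * `|b - a|.
  move=> ab.
  have [c _ ->] := @MVT_segment R f _ a b ab (fun s _ => df s) (continuous_subspaceT cf).
  by rewrite normrM ler_wpM2r.
have fx : w x = f 0 by rewrite /f scale0r addr0.
rewrite fx -[w _]/(f t).
have [t0|t0] := leP 0 t; first by have := key _ _ t0; rewrite subr0.
by have := key _ _ (ltW t0); rewrite distrC sub0r normrN.
Qed.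

Lemma mean_value_plane (w : R * R -> R) (S1 S2 : R) :
  (forall y, derivable w y (1, 0)) -> (forall y, derivable w y (0, 1)) ->
  (forall y, `|'D_(1, 0) w y| <= S1) -> (forall y, `|'D_(0, 1) w y| <= S2) ->
  separately_lipschitz S1 S2 w.
Proof.
move=> d1 d2 b1 b2 x y.
(* From [y] to [x] through the corner [(x.1, y.2)], changing one coordinate at a time. *)
rewrite -(subrKA (w (x.1, y.2))) (le_trans (ler_normD _ _))// addrC; apply: lerD.
- have := directional_lipschitz y (x.1 - y.1) d1 b1.
  congr (`|w _ - _| <= _); case: x y => [x1 x2] [y1 y2] /=.
  by congr pair; rewrite /= ?[_ *: 1]mulr1 ?scaler0; ring.
- have := directional_lipschitz (x.1, y.2) (x.2 - y.2) d2 b2.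
  congr (`|w _ - _| <= _); case: x y => [x1 x2] [y1 y2] /=.
  by congr pair; rewrite /= ?[_ *: 1]mulr1 ?scaler0; ring.
Qed.

End MeanValue.

Section Phi.
Variables (R : realType) (phi : R * R -> R[i]) (N1 M1 N2 M2 : R).
Hypotheses (C1phi : C1_complex phi) (phi_box : supp phi `<=` box N1 M1 N2 M2).

Lemma supp_off x : ~ box N1 M1 N2 M2 x -> phi x = 0.
Proof.
move=> xB; have [//|phix] := eqVneq (phi x) 0; exfalso; apply: xB; apply: phi_box.
exact: subset_closure.
Qed.

Lemma box_closed : closed (box N1 M1 N2 M2).
Proof.
apply: compact_closed; first exact: norm_hausdorff.
by apply: compact_setX; exact: segment_compact.
Qed.

Lemma box_max_bound x : box N1 M1 N2 M2 x ->
  (`|x.1| <= max_bound N1 M1 N2 M2) && (`|x.2| <= max_bound N1 M1 N2 M2).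
Proof.
have itv_norm (N M y : R) : N <= y <= M -> `|y| <= Num.max `|N| `|M|.
  move=> /andP[Ny yM]; rewrite le_max !ler_norml.
  have [y0|y0] := leP 0 y; apply/orP; [right|left].
    by rewrite (le_trans yM (ler_norm _)) andbT (le_trans _ y0)// oppr_le0.
  rewrite (le_trans (ltW y0))// andbT lerNl -normrN (le_trans _ (ler_norm _))//.
  by rewrite lerN2.
move=> [/= x1 x2]; rewrite /max_bound; move: x1 x2; rewrite !in_itv /= => /itv_norm x1 /itv_norm x2.
by apply/andP; split; rewrite le_max ?x1 ?x2 ?orbT.
Qed.

Lemma phi_vanishes (w : R * R -> R) : (forall x, phi x = 0 -> w x = 0) ->
  vanishes_off (max_bound N1 M1 N2 M2) w.
Proof.
move=> pw x; rewrite !ltNge -negb_and => /negP h; apply/pw/supp_off.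
by move/box_max_bound.
Qed.

(** The moduli of a continuous function on a compact set are bounded, so the [sup] is a genuine
    upper bound. *)
Lemma sup_norm_bound (g : R * R -> R[i]) (D : set (R * R)) x : compact D ->
  continuous (fun x => complex.Re (g x)) -> continuous (fun x => complex.Im (g x)) ->
  D x -> normc (g x) <= sup_norm D g.
Proof.
move=> cD cRe cIm Dx; apply: ub_le_sup; last by exists x.
have cg : continuous (fun x => normc (g x)).
  move=> y; under eq_fun do rewrite normcE.
  apply: (@cvg_comp _ _ _ (fun y => complex.Re (g y) ^+ 2 + complex.Im (g y) ^+ 2) Num.sqrt _
     (nbhs (complex.Re (g y) ^+ 2 + complex.Im (g y) ^+ 2))); last exact: sqrt_continuous.
  apply: cvgD; under eq_fun do rewrite expr2; rewrite expr2; apply: cvgM;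
    by [exact: cRe | exact: cIm].
have /compact_bounded [B [_ BP]] : compact ((fun x => normc (g x)) @` D).
  by apply: continuous_compact => //; exact: continuous_subspaceT.
exists (B + 1) => y Dy; rewrite (le_trans (ler_norm _))// (BP (B + 1))//.
by rewrite ltrDl.
Qed.

(** The real part of [(a - i b) * phi]. With [(a, b)] a unit vector, its derivatives are bounded by
    the moduli of those of [phi], so no constant is lost. *)
Definition direction_part (a b : R) x := a * complex.Re (phi x) + b * complex.Im (phi x).

Lemma derive_direction_part (a b : R) (v x : R * R) : v \in [:: (1, 0); (0, 1)] ->
  derivable (direction_part a b) x v /\
  'D_v (direction_part a b) x =
    a * complex.Re (Cderive v phi x) + b * complex.Im (Cderive v phi x).
Proof.
move=> vv; have [/(_ v vv)[d1 _] /(_ v vv)[d2 _]] := C1phi.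
have E : direction_part a b =
    (a \*: (fun x => complex.Re (phi x)) : R * R -> R) + b \*: (fun x => complex.Im (phi x)).
  by [].
have e1 := derivableZ (k := a) (d1 x); have e2 := derivableZ (k := b) (d2 x).
by rewrite E; split; [exact: derivableD | rewrite deriveD// !deriveZ].
Qed.

(** Inside the box this is Cauchy-Schwarz and the definition of the sup norm. On the open complement
    [phi] vanishes, hence so does the derivative, and a point of the box shows that the bound is
    nonnegative. *)
Lemma derive_direction_part_le (a b : R) (v x : R * R) : a ^+ 2 + b ^+ 2 = 1 ->
  box N1 M1 N2 M2 !=set0 -> v \in [:: (1, 0); (0, 1)] ->
  `|'D_v (direction_part a b) x| <= sup_norm (box N1 M1 N2 M2) (Cderive v phi).
Proof.
move=> ab [z Bz] vv.
have [cRe cIm] : continuous (fun x => complex.Re (Cderive v phi x)) /\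
    continuous (fun x => complex.Im (Cderive v phi x)).
  by have [/(_ v vv)[_ ?] /(_ v vv)[_ ?]] := C1phi.
have cB : compact (box N1 M1 N2 M2) by apply: compact_setX; exact: segment_compact.
have [xB|xB] := pselect (box N1 M1 N2 M2 x).
  rewrite (derive_direction_part a b x vv).2.
  by rewrite (le_trans (normc_direction_le _ ab))// sup_norm_bound.
have -> : 'D_v (direction_part a b) x = 0.
  rewrite -(derive_cst (0 : R) x v); apply: near_eq_derive.
  have : nbhs x (~` box N1 M1 N2 M2).
    by apply: open_nbhs_nbhs; split => //; apply: closed_openC; exact: box_closed.
  by apply: filterS => y /supp_off py; rewrite /direction_part py /= !mulr0 addr0.
rewrite normr0 (le_trans (normc_ge0 (Cderive v phi z)))// sup_norm_bound//.
Qed.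

Lemma direction_part_lipschitz (a b : R) : a ^+ 2 + b ^+ 2 = 1 ->
  box N1 M1 N2 M2 !=set0 ->
  separately_lipschitz (sup_norm (box N1 M1 N2 M2) (Cderive (1, 0) phi))
    (sup_norm (box N1 M1 N2 M2) (Cderive (0, 1) phi)) (direction_part a b).
Proof.
move=> ab B0.
have v1 : ((1, 0) : R * R) \in [:: (1, 0); (0, 1)] by rewrite inE eqxx.
have v2 : ((0, 1) : R * R) \in [:: (1, 0); (0, 1)] by rewrite !inE eqxx orbT.
apply: mean_value_plane => y.
- exact: (derive_direction_part a b y v1).1.
- exact: (derive_direction_part a b y v2).1.
- exact: derive_direction_part_le.
- exact: derive_direction_part_le.
Qed.

End Phi.

(** * The Radon transform of phi *)

Section Radon.
Variables (R : realType) (phi : R * R -> R[i]) (N1 M1 N2 M2 : R) (p : R * R).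
Hypotheses (C1phi : C1_complex phi) (phi_box : supp phi `<=` box N1 M1 N2 M2).
Hypotheses (phi_hat : fourier2 phi (0, 0) != 0) (p_unit : p.1 ^+ 2 + p.2 ^+ 2 = 1).
Notation mu := (@lebesgue_measure R).
Let M := max_bound N1 M1 N2 M2.
Let S1 := sup_norm (box N1 M1 N2 M2) (Cderive (1, 0) phi).
Let S2 := sup_norm (box N1 M1 N2 M2) (Cderive (0, 1) phi).

(** An empty box would force [phi = 0], against the nonzero Fourier transform at the origin. *)
Lemma box_neq0 : box N1 M1 N2 M2 !=set0.
Proof.
apply: contrapT => /set0P/negP; rewrite negbK => /eqP B0.
have phi0 x : phi x = 0 by apply: (supp_off phi_box); rewrite B0.
move: phi_hat; rewrite /fourier2 /Cintegral.
under eq_Rintegral do rewrite phi0 mul0r.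
under [X in _ +i* X]eq_Rintegral do rewrite phi0 mul0r.
by rewrite !Rintegral0 eqxx.
Qed.

(** [C1_complex] speaks of partial derivatives only; continuity comes from the Lipschitz estimate in
    the directions [(1, 0)] and [(0, 1)]. *)
Lemma phi_re_im : continuous (fun x => complex.Re (phi x)) /\
  continuous (fun x => complex.Im (phi x)).
Proof.
split.
- have -> : (fun x => complex.Re (phi x)) = direction_part phi 1 0.
    by apply/funext => x; rewrite /direction_part mul1r mul0r addr0.
  apply: separately_lipschitz_continuous.
  apply: (direction_part_lipschitz C1phi phi_box _ box_neq0).
  by rewrite expr1n expr0n addr0.
- have -> : (fun x => complex.Im (phi x)) = direction_part phi 0 1.
    by apply/funext => x; rewrite /direction_part mul1r mul0r add0r.
  apply: separately_lipschitz_continuous.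
  apply: (direction_part_lipschitz C1phi phi_box _ box_neq0).
  by rewrite expr1n expr0n add0r.
Qed.

Let vRe : vanishes_off M (fun x => complex.Re (phi x)).
Proof. by apply: (phi_vanishes phi_box) => x ->. Qed.

Let vIm : vanishes_off M (fun x => complex.Im (phi x)).
Proof. by apply: (phi_vanishes phi_box) => x ->. Qed.

Lemma radon_supp t : Num.sqrt 2 * M < `|t| -> radon p phi t = 0.
Proof.
move=> tM; apply/eqP; rewrite eq_complex; apply/andP; split; apply/eqP.
- exact: (real_radon_supp p_unit vRe tM).
- exact: (real_radon_supp p_unit vIm tM).
Qed.

Lemma radon_direction a b t :
  a * complex.Re (radon p phi t) + b * complex.Im (radon p phi t) =
  real_radon p (direction_part phi a b) t.
Proof.
have iRe := real_radon_integrable p_unit vRe t phi_re_im.1.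
have iIm := real_radon_integrable p_unit vIm t phi_re_im.2.
rewrite /= -!RintegralZl// -RintegralD//.
- exact: (eq_integrable _ _ _ _ (integrableZl measurableT a iRe)).
- exact: (eq_integrable _ _ _ _ (integrableZl measurableT b iIm)).
Qed.

Lemma sup_norm_ge0 (D : set (R * R)) (g : R * R -> R[i]) : 0 <= sup_norm D g.
Proof.
(* When the supremum does not exist, [sup] takes the default value 0. *)
rewrite /sup_norm; have [[/= ub D0]|/sup_out->//] := pselect (has_sup [set normc (g x) | x in D]).
have [_ [x Dx _]] := ub.
by rewrite (le_trans (normc_ge0 (g x)))// ub_le_sup//; exists x.
Qed.

Lemma max_bound_ge0 : 0 <= M.
Proof. by rewrite /M /max_bound !le_max normr_ge0. Qed.

(** The direction [(a, b)] is chosen to realise the modulus of the difference; the real estimate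
    then applies to [direction_part phi a b]. *)
Lemma radon_lipschitz t t' :
  normc (radon p phi t - radon p phi t') <= 2 * Num.sqrt 2 * M * (S1 + S2) * `|t - t'|.
Proof.
have [a [b [ab <-]]] := normc_direction (radon p phi t - radon p phi t').
have -> : a * complex.Re (radon p phi t - radon p phi t') +
    b * complex.Im (radon p phi t - radon p phi t') =
    (a * complex.Re (radon p phi t) + b * complex.Im (radon p phi t)) -
    (a * complex.Re (radon p phi t') + b * complex.Im (radon p phi t')).
  by case: (radon p phi t) (radon p phi t') => [x1 x2] [y1 y2] /=; ring.
rewrite !radon_direction (le_trans (ler_norm _))//.
apply: real_radon_lipschitz => //; rewrite ?max_bound_ge0 ?sup_norm_ge0//.
- by apply: (phi_vanishes phi_box) => x px; rewrite /direction_part px /= !mulr0 addr0.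
- exact: (direction_part_lipschitz C1phi phi_box ab box_neq0).
Qed.

Lemma radon_neq0 : exists t, radon p phi t != 0.
Proof.
apply: contrapT => h.
have rad0 t : radon p phi t = 0.
  by apply/eqP/negPn/negP => rt; apply: h; exists t.
have Re0 : Rintegral (mu \x mu)%E setT (fun x => complex.Re (phi x)) = 0.
  apply: (plane_integral_eq0 phi_re_im.1 vRe p_unit) => t.
  by have := rad0 t; move=> /(congr1 (@complex.Re R)).
have Im0 : Rintegral (mu \x mu)%E setT (fun x => complex.Im (phi x)) = 0.
  apply: (plane_integral_eq0 phi_re_im.2 vIm p_unit) => t.
  by have := rad0 t; move=> /(congr1 (@complex.Im R)).
have E x : phi x * (cos (dot2 x (0, 0)) -i* sin (dot2 x (0, 0))) = phi x.
  by rewrite /dot2 /= !mulr0 addr0 cos0 sin0 oppr0 mulr1.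
move/eqP : phi_hat; apply; rewrite /fourier2 /Cintegral.
under eq_Rintegral do rewrite E.
under [X in _ +i* X]eq_Rintegral do rewrite E.
by rewrite Re0 Im0.
Qed.

(** Were the Lipschitz constant at most 0, the Radon transform would be constant, equal to its value
    0 outside the support. This makes the denominator of [delta] positive. *)
Lemma radon_lipschitz_gt0 : 0 < M /\ 0 < S1 + S2.
Proof.
have [t0 rt0] := radon_neq0.
suff : 0 < 2 * Num.sqrt 2 * M * (S1 + S2).
  have M0 := max_bound_ge0.
  have S0 : 0 <= S1 + S2 by rewrite addr_ge0 ?sup_norm_ge0.
  move=> h; split; rewrite lt_neqAle ?M0 ?S0 andbT eq_sym; apply: contraTneq h => ->;
    by rewrite ?mulr0 ?mul0r ltxx.
rewrite ltNge; apply/negP => L0.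
have r0 : 0 <= Num.sqrt 2 * M by rewrite mulr_ge0 ?sqrtr_ge0 ?max_bound_ge0.
move/eqP : rt0; apply; apply: ComplexField.Normc.eq0_normc; apply/eqP.
rewrite eq_le normc_ge0 andbT.
have far : radon p phi (Num.sqrt 2 * M + 1) = 0.
  by apply: radon_supp; rewrite gtr0_norm ?ltrDl//; lra.
rewrite -[radon p phi t0]subr0 -far (le_trans (radon_lipschitz _ _))//.
by rewrite mulr_le0_ge0.
Qed.

End Radon.

(** * The least eigenvalue of a Hermitian matrix *)

Section MinimalEigenvalue.
Local Open Scope sesquilinear_scope.
Variable R : realType.
Let C : numClosedFieldType := R[i].

Definition quadratic_form n (G : 'M[C]_n) (v : 'rV[C]_n) : C := (v *m G *m v ^t*) 0 0.

Lemma quadratic_form1 n (v : 'rV[C]_n) :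
  quadratic_form 1%:M v = (\sum_i normc (v 0 i) ^+ 2)%:C.
Proof.
rewrite /quadratic_form mulmx1 mxE rmorph_sum; apply: eq_bigr => i _.
by rewrite !mxE -sqr_normc rmorphXn.
Qed.

(** The unitary diagonalisation of [G] makes the form diagonal in the coordinates
    [v *m (spectralmx G) ^t*], with real coefficients because [G] is Hermitian. *)
Lemma quadratic_form_spectral n (G : 'M[C]_n) (v : 'rV[C]_n) : G \is hermsymmx ->
  quadratic_form G v =
  (\sum_i complex.Re (spectral_diag G 0 i) * normc ((v *m (spectralmx G) ^t*) 0 i) ^+ 2)%:C.
Proof.
move=> Gh.
have Ureal := hermitian_spectral_diag_real Gh.
have Uunit := spectral_unitarymx G.
rewrite /quadratic_form {1}(orthomx_spectralP (hermitian_normalmx Gh)).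
rewrite invmx_unitary// !mulmxA -[_ *m spectralmx G *m _]mulmxA.
have -> : spectralmx G *m v ^t* = (v *m (spectralmx G) ^t*) ^t*.
  by rewrite trmx_mul map_mxM trmxCK.
set y := v *m _; rewrite mul_mx_diag mxE rmorph_sum; apply: eq_bigr => i _.
have /mxOverP/(_ 0 i) Di := Ureal.
rewrite !mxE rmorphM rmorphXn /= (RRe_real Di).
by rewrite mulrAC mulrC; congr (_ * _); exact/esym/sqr_normc.
Qed.

Lemma unitary_sum_normc n (U : 'M[C]_n) (v : 'rV[C]_n) : U \is unitarymx ->
  \sum_i normc ((v *m U ^t*) 0 i) ^+ 2 = \sum_i normc (v 0 i) ^+ 2.
Proof.
move=> Uu; apply: complexI; rewrite -!quadratic_form1 /quadratic_form !mulmx1.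
rewrite trmx_mul map_mxM trmxCK !mulmxA -[_ *m U ^t* *m U]mulmxA.
by rewrite -invmx_unitary// mulVmx ?mulmx1// unitarymx_unit.
Qed.

(** The [i]-th row of the diagonalising matrix is a left eigenvector; it is nonzero because that
    matrix is invertible. *)
Lemma eigenvalue_spectral_diag n (G : 'M[C]_n) i : G \is hermsymmx ->
  eigenvalue G (complex.Re (spectral_diag G 0 i))%:C.
Proof.
move=> Gh; have /mxOverP/(_ 0 i) Di := hermitian_spectral_diag_real Gh.
rewrite (RRe_real Di); apply/eigenvalueP; exists (row i (spectralmx G)).
  rewrite {2}(orthomx_spectralP (hermitian_normalmx Gh)) -row_mul !mulmxA.
  rewrite mulmxV ?spectral_unit// mul1mx row_mul.
  by rewrite row_diag_mx -scalemxAl -rowE.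
apply/negP => /eqP r0; have := spectral_unit G.
rewrite -row_free_unit => /row_freeP [B SB].
have : row i (spectralmx G *m B) = 0 by rewrite row_mul r0 mul0mx.
rewrite SB => /rowP/(_ i); rewrite !mxE eqxx => /eqP.
by rewrite oner_eq0.
Qed.

Lemma sum_normc_gt0 n (v : 'rV[C]_n) : v != 0 -> 0 < \sum_i normc (v 0 i) ^+ 2.
Proof.
move=> /rV0Pn [i vi]; rewrite (bigD1 i)//= ltr_wpDr//.
  by apply: sumr_ge0 => j _; rewrite sqr_ge0.
rewrite exprn_gt0// lt_neqAle normc_ge0 andbT eq_sym.
by apply: contra vi => /eqP/ComplexField.Normc.eq0_normc ->.
Qed.

Lemma eigenvalue_quadratic_form n (G : 'M[C]_n) (r : R) : eigenvalue G r%:C ->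
  exists2 v : 'rV[C]_n, v != 0 &
    quadratic_form G v = (r * \sum_i normc (v 0 i) ^+ 2)%:C.
Proof.
move=> /eigenvalueP [v vG v0]; exists v => //.
by rewrite rmorphM /= -quadratic_form1 /quadratic_form mulmx1 vG -scalemxAl mxE.
Qed.

(** The infimum is at most every diagonal entry, which gives the lower bound for the form. Every
    eigenvalue is at least the least diagonal entry, which keeps the infimum positive; [0 < n] makes
    the set of eigenvalues nonempty. *)
Lemma lambda_min_spec n (G : 'M[C]_n) : (0 < n)%N -> G \is hermsymmx ->
  (forall v : 'rV[C]_n, v != 0 -> 0 < quadratic_form G v) ->
  0 < lambda_min G /\
  forall v : 'rV[C]_n, (lambda_min G * \sum_i normc (v 0 i) ^+ 2)%:C <= quadratic_form G v.
Proof.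
move=> n0 Gh Gpos.
pose D i := complex.Re (spectral_diag G 0 i).
have ev_gt0 r : eigenvalue G r%:C -> 0 < r.
  move=> /eigenvalue_quadratic_form [v v0 qv]; have := Gpos v v0.
  by rewrite qv ltcR pmulr_lgt0// sum_normc_gt0.
have D_gt0 i : 0 < D i by exact/ev_gt0/eigenvalue_spectral_diag.
have lb0 : has_lbound [set r : R | eigenvalue G r%:C].
  by exists 0 => r /ev_gt0/ltW.
split.
(* The start value 1 is harmless: only a positive lower bound for the eigenvalues is wanted. *)
- pose e := \big[Num.min/1]_i D i.
  have e_gt0 : 0 < e by apply: lt_bigmin => // i _; exact: D_gt0.
  apply: (lt_le_trans e_gt0); apply: lb_le_inf.
    by exists (D (Ordinal n0)); exact: eigenvalue_spectral_diag.
  move=> r /eigenvalue_quadratic_form [v v0 qv].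
  have s0 := sum_normc_gt0 v0.
  rewrite -(ler_pM2r s0) -lecR -qv quadratic_form_spectral// lecR.
  rewrite -(unitary_sum_normc v (spectral_unitarymx G)) mulr_sumr.
  apply: ler_sum => i _; apply: ler_wpM2r; first exact: sqr_ge0.
  exact: bigmin_le_cond.
- move=> v; rewrite quadratic_form_spectral// lecR.
  rewrite -(unitary_sum_normc v (spectral_unitarymx G)) mulr_sumr.
  apply: ler_sum => i _; apply: ler_wpM2r; first exact: sqr_ge0.
  by apply: ge_inf => //; exact: eigenvalue_spectral_diag.
Qed.

End MinimalEigenvalue.

(** * Complex-valued integrals *)

Section ComplexIntegral.
Variable R : realType.
Notation mu := (@lebesgue_measure R).
Implicit Types f h : R -> R[i].

(** Continuity is asked of the two real components because [Cintegral] integrates them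
    separately. *)
Definition continuous_csupp f :=
  [/\ continuous (fun x => complex.Re (f x)), continuous (fun x => complex.Im (f x)) &
      exists r, forall x, r < `|x| -> f x = 0].

Lemma continuous_csupp_integrable f : continuous_csupp f ->
  mu.-integrable setT (EFin \o (fun x => complex.Re (f x))) /\
  mu.-integrable setT (EFin \o (fun x => complex.Im (f x))).
Proof.
move=> [cRe cIm [r f0]].
by split; apply: (integrable_csupp (r := r)) => // x /f0 ->.
Qed.

Lemma continuous_csupp0 : continuous_csupp (fun _ => 0).
Proof. by split; [move=> x; exact: cvg_cst|move=> x; exact: cvg_cst|exists 0]. Qed.

Lemma continuous_csuppD f h : continuous_csupp f -> continuous_csupp h ->
  continuous_csupp (fun x => f x + h x).
Proof.
move=> [fRe fIm [r f0]] [hRe hIm [r' h0]]; split.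
- have -> : (fun x => complex.Re (f x + h x)) = (fun x => complex.Re (f x) + complex.Re (h x)).
    by apply/funext => x; case: (f x) (h x) => [? ?] [].
  by move=> x; apply: cvgD; [exact: fRe|exact: hRe].
- have -> : (fun x => complex.Im (f x + h x)) = (fun x => complex.Im (f x) + complex.Im (h x)).
    by apply/funext => x; case: (f x) (h x) => [? ?] [].
  by move=> x; apply: cvgD; [exact: fIm|exact: hIm].
- exists (Num.max r r') => x; rewrite gt_max => /andP[/f0 -> /h0 ->].
  by rewrite addr0.
Qed.

Lemma continuous_csuppM f h : continuous (fun x => complex.Re (h x)) ->
  continuous (fun x => complex.Im (h x)) -> continuous_csupp f ->
  continuous_csupp (fun x => h x * f x).
Proof.
move=> hRe hIm [fRe fIm [r f0]]; split.
- have -> : (fun x => complex.Re (h x * f x)) =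
      (fun x => complex.Re (h x) * complex.Re (f x) - complex.Im (h x) * complex.Im (f x)).
    by apply/funext => x; case: (h x) (f x) => [? ?] [].
  by move=> x; apply: cvgB; apply: cvgM; by [exact: hRe|exact: fRe|exact: hIm|exact: fIm].
- have -> : (fun x => complex.Im (h x * f x)) =
      (fun x => complex.Re (h x) * complex.Im (f x) + complex.Im (h x) * complex.Re (f x)).
    by apply/funext => x; case: (h x) (f x) => [? ?] [].
  by move=> x; apply: cvgD; apply: cvgM; by [exact: hRe|exact: fRe|exact: hIm|exact: fIm].
- by exists r => x /f0 ->; rewrite mulr0.
Qed.

Lemma continuous_csuppZ (c : R[i]) f : continuous_csupp f ->
  continuous_csupp (fun x => c * f x).
Proof. by apply: (continuous_csuppM (h := cst c)) => x; exact: cvg_cst. Qed.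

Lemma continuous_csuppC f : continuous_csupp f -> continuous_csupp (fun x => (f x)^*).
Proof.
move=> [fRe fIm [r f0]]; split.
- have -> : (fun x => complex.Re (f x)^*) = (fun x => complex.Re (f x)).
    by apply/funext => x; case: (f x).
  exact: fRe.
- have -> : (fun x => complex.Im (f x)^*) = (fun x => - complex.Im (f x)).
    by apply/funext => x; case: (f x).
  by move=> x; apply: cvgN; exact: fIm.
- by exists r => x /f0 ->; rewrite conjc0.
Qed.

Lemma continuous_csupp_shift f (a : R) : continuous_csupp f ->
  continuous_csupp (fun x => f (x - a)).
Proof.
move=> [fRe fIm [r f0]].
have ca : continuous (fun x : R => x - a).
  by move=> x; apply: cvgB; [exact: cvg_id|exact: cvg_cst].
split.
- by move=> x; apply: (continuous_comp (ca x) (fRe _)).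
- by move=> x; apply: (continuous_comp (ca x) (fIm _)).
- exists (r + `|a|) => x rx; apply: f0.
  have := lerB_dist x a; lra.
Qed.

Lemma continuous_csupp_sum (I : Type) (s : seq I) (F : I -> R -> R[i]) :
  (forall i, continuous_csupp (F i)) -> continuous_csupp (fun x => \sum_(i <- s) F i x).
Proof.
move=> cF; elim: s => [|i s IH].
  by under eq_fun do rewrite big_nil; exact: continuous_csupp0.
by under eq_fun do rewrite big_cons; exact: continuous_csuppD.
Qed.

Lemma CintegralD f h : continuous_csupp f -> continuous_csupp h ->
  Cintegral mu setT (fun x => f x + h x) = Cintegral mu setT f + Cintegral mu setT h.
Proof.
move=> /continuous_csupp_integrable[fRe fIm] /continuous_csupp_integrable[hRe hIm].
apply/eqP; rewrite eq_complex /= -!RintegralD//.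
by apply/andP; split; apply/eqP; apply: eq_Rintegral => x _; case: (f x) (h x) => [? ?] [].
Qed.

Lemma CintegralZ c f : continuous_csupp f ->
  Cintegral mu setT (fun x => c * f x) = c * Cintegral mu setT f.
Proof.
move=> /continuous_csupp_integrable[fRe fIm].
have iZ a (u : R -> R) : mu.-integrable setT (EFin \o u) ->
    mu.-integrable setT (EFin \o (fun x => a * u x)).
  by move=> iu; apply: eq_integrable (integrableZl measurableT a iu).
case: c => a b; apply/eqP; rewrite eq_complex /= -!RintegralZl// -RintegralB -?RintegralD//;
  try exact: iZ.
by apply/andP; split; apply/eqP; apply: eq_Rintegral => x _; case: (f x).
Qed.

Lemma Cintegral_sum (I : Type) (s : seq I) (F : I -> R -> R[i]) :
  (forall i, continuous_csupp (F i)) ->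
  Cintegral mu setT (fun x => \sum_(i <- s) F i x) = \sum_(i <- s) Cintegral mu setT (F i).
Proof.
move=> cF; elim: s => [|i s IH].
  under eq_fun do rewrite big_nil; rewrite big_nil.
  by apply/eqP; rewrite eq_complex /= !Rintegral0 eqxx.
under eq_fun do rewrite big_cons; rewrite big_cons CintegralD ?IH//.
exact: continuous_csupp_sum.
Qed.

Lemma Cintegral_real (u : R -> R) :
  Cintegral mu setT (fun x => (u x)%:C) = (\int[mu]_x u x)%:C.
Proof. by apply/eqP; rewrite eq_complex /= Rintegral0 !eqxx. Qed.

Lemma normc_lipschitz_continuous f (L : R) :
  (forall x y, normc (f x - f y) <= L * `|x - y|) ->
  continuous (fun x => complex.Re (f x)) /\ continuous (fun x => complex.Im (f x)).
Proof.
move=> fL.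
have key a b : a ^+ 2 + b ^+ 2 = 1 ->
    continuous (fun x => a * complex.Re (f x) + b * complex.Im (f x)).
  (* The function is extended to the plane, constant in the second variable, to reuse the continuity
     of separately Lipschitz functions. *)
  move=> ab; have Lw : separately_lipschitz L 0 (fun z : R * R =>
      a * complex.Re (f z.1) + b * complex.Im (f z.1)).
    move=> z z'; rewrite mul0r addr0; apply: le_trans (fL _ _).
    rewrite (_ : _ - _ = a * complex.Re (f z.1 - f z'.1) + b * complex.Im (f z.1 - f z'.1)).
      exact: normc_direction_le.
    by case: (f z.1) (f z'.1) => [? ?] [? ?] /=; ring.
  apply: (continuous_comp_pair (g := cst 0) (separately_lipschitz_continuous Lw)) => x.
    exact: cvg_id.
  exact: cvg_cst.
split.
- have -> : (fun x => complex.Re (f x)) = (fun x => 1 * complex.Re (f x) + 0 * complex.Im (f x)).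
    by apply/funext => x; rewrite mul1r mul0r addr0.
  by apply: key; rewrite expr1n expr0n addr0.
- have -> : (fun x => complex.Im (f x)) = (fun x => 0 * complex.Re (f x) + 1 * complex.Im (f x)).
    by apply/funext => x; rewrite mul1r mul0r add0r.
  by apply: key; rewrite expr1n expr0n add0r.
Qed.

End ComplexIntegral.

(** * Combinations of shifts *)

(** Both sides are double sums, compared termwise by [a * b <= (a ^+ 2 + b ^+ 2) / 2]. *)
Lemma sqr_sum_le (R : realFieldType) n (a : 'I_n -> R) :
  (\sum_i a i) ^+ 2 <= n%:R * \sum_i a i ^+ 2.
Proof.
have E : (\sum_i a i) ^+ 2 = \sum_i \sum_j a i * a j.
  by rewrite expr2 mulr_suml; apply: eq_bigr => i _; rewrite mulr_sumr.
have E2 : n%:R * \sum_i a i ^+ 2 = \sum_i \sum_j (a i ^+ 2 + a j ^+ 2) / 2.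
  under [RHS]eq_bigr do rewrite -mulr_suml big_split /= sumr_const card_ord.
  by rewrite -mulr_suml big_split /= sumr_const card_ord sumrMnl -mulr_natl; field.
rewrite E E2; apply: ler_sum => i _; apply: ler_sum => j _.
by have := sqr_ge0 (a i - a j); rewrite sqrrB; lra.
Qed.

Section Shifts.
Variables (R : realType) (g : R -> R[i]) (r L : R) (n : nat) (s : 'I_n -> R).
Hypotheses (g_lip : forall x y, normc (g x - g y) <= L * `|x - y|).
Hypotheses (g_supp : forall x, r < `|x| -> g x = 0) (g_neq0 : exists t, g t != 0).
Hypothesis s_inj : injective s.
Notation mu := (@lebesgue_measure R).

Definition shift_combination (v : 'I_n -> R[i]) (x : R) : R[i] :=
  \sum_m v m * g (x - s m).

Let Lge0 : 0 <= L.
Proof.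
by have := g_lip 1 0; rewrite subr0 normr1 mulr1; apply: le_trans; exact: normc_ge0.
Qed.

(* Just to the left of [T + s m], with [T] the right end of the support of [g] and
   [s m] the largest shift present, only the [m]-th term is nonzero. *)
Lemma shift_combination_independent (v : 'I_n -> R[i]) :
  (forall x, shift_combination v x = 0) -> forall m, v m = 0.
Proof.
move=> v0 m0; apply/eqP/negPn/negP => vm0.
case: (@Order.TotalTheory.arg_maxP _ R 'I_n m0 (fun m => v m != 0) s vm0) => m vm smax.
pose T := sup [set t | g t != 0].
have hT : has_sup [set t | g t != 0].
  split; first by have [t gt] := g_neq0; exists t.
  exists r => t; apply: contraNle => rt; rewrite g_supp//.
  by rewrite (lt_le_trans rt) ?ler_norm.
(* At most every gap from [s m] down to a smaller shift; the start value 1 keeps it positive when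
   there is none. *)
pose d := \big[Num.min/1]_(i | s i < s m) (s m - s i).
have d_gt0 : 0 < d by apply: lt_bigmin => // i; rewrite subr_gt0.
(* As [t > T - d], any [s i < s m] gives [t + s m - s i > T], where [g] vanishes. *)
have [t gt Tt] := sup_adherent d_gt0 hT.
have := v0 (t + s m); rewrite /shift_combination (bigD1 m)//= big1 ?addr0.
  by rewrite addrK => /eqP; rewrite mulf_eq0 (negbTE vm) (negbTE gt).
move=> i im; have [->|vi] := eqVneq (v i) 0; first by rewrite mul0r.
have sim : s i < s m.
  have /= := smax i vi; rewrite lt_neqAle => ->; rewrite andbT.
  by apply: contra im => /eqP/s_inj ->.
have dle : d <= s m - s i by exact: bigmin_le_cond.
have [->|gi] := eqVneq (g (t + s m - s i)) 0; first by rewrite mulr0.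
have Th : t + s m - s i <= T by exact: sup_upper_bound.
by exfalso; move: Tt dle; rewrite -/T; lra.
Qed.

Lemma shift_combination_lipschitz (v : 'I_n -> R[i]) x y :
  normc (shift_combination v x - shift_combination v y) <=
  L * `|x - y| * \sum_m normc (v m).
Proof.
rewrite /shift_combination -sumrB.
have normc_sum (F : 'I_n -> R[i]) : normc (\sum_m F m) <= \sum_m normc (F m).
  elim/big_ind2 : _ => [|a b c d ab cd|//]; first by rewrite ComplexField.Normc.normc0.
  by rewrite (le_trans (le_normcD _ _))// lerD.
rewrite (le_trans (normc_sum _))// mulr_sumr; apply: ler_sum => m _.
rewrite -mulrBr ComplexField.Normc.normcM mulrC ler_wpM2r ?normc_ge0//.
rewrite (le_trans (g_lip _ _))// ler_wpM2l//.
by rewrite (_ : x - s m - (y - s m) = x - y) //; ring.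
Qed.

Definition shift_gram : 'M[R[i]]_n := \matrix_(j, m) Cintegral mu [set: R] (fun x =>
  g (x - s j) * (g (x - s m))^*).

Let cg : continuous_csupp g.
Proof.
by have [? ?] := normc_lipschitz_continuous g_lip; split => //; exists r.
Qed.

Let cgm m : continuous_csupp (fun x => g (x - s m)).
Proof. exact: continuous_csupp_shift. Qed.

Let cgg j m : continuous_csupp (fun x => g (x - s j) * (g (x - s m))^*).
Proof.
have [? ? _] := cgm j.
by apply: continuous_csuppM => //; apply: continuous_csuppC.
Qed.

Local Open Scope sesquilinear_scope.

Lemma shift_gram_hermitian : shift_gram \is hermsymmx.
Proof.
apply/is_hermitianmxP; rewrite expr0 scale1r; apply/matrixP => j m; rewrite !mxE.
apply/eqP; rewrite eq_complex; apply/andP; split; apply/eqP => /=.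
- apply: eq_Rintegral => x _; case: (g (x - s j)) (g (x - s m)) => [? ?] [? ?] /=; ring.
- have [_ i2] := continuous_csupp_integrable (cgg m j).
  rewrite -[RHS]mulN1r -RintegralZl//.
  apply: eq_Rintegral => x _; case: (g (x - s j)) (g (x - s m)) => [? ?] [? ?] /=; ring.
Qed.

(** The product of the combination with its conjugate is expanded into a double sum and integrated
    term by term. *)
Lemma shift_gram_quadratic_form (v : 'rV[R[i]]_n) :
  quadratic_form shift_gram v =
  (\int[mu]_x normc (shift_combination (v 0) x) ^+ 2)%:C.
Proof.
rewrite -Cintegral_real.
have E x : (normc (shift_combination (v 0) x) ^+ 2)%:C =
    \sum_m \sum_j v 0 j * (v 0 m)^* * (g (x - s j) * (g (x - s m))^*).
  rewrite rmorphXn /= -[LHS]/(`|shift_combination (v 0) x| ^+ 2) sqr_normc.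
  rewrite /shift_combination rmorph_sum /= mulr_sumr; apply: eq_bigr => m _.
  rewrite mulr_suml; apply: eq_bigr => j _.
  by rewrite rmorphM /=; ring.
under eq_fun do rewrite E.
rewrite Cintegral_sum; last first.
  by move=> m; apply: continuous_csupp_sum => j; exact: continuous_csuppZ.
rewrite /quadratic_form mxE; apply: eq_bigr => m _.
rewrite Cintegral_sum; last by move=> j; exact: continuous_csuppZ.
rewrite mxE mulr_suml; apply: eq_bigr => j _.
by rewrite CintegralZ// !mxE mulrAC.
Qed.

Lemma shift_combination_csupp (v : 'I_n -> R[i]) : continuous_csupp (shift_combination v).
Proof. by apply: continuous_csupp_sum => m; exact: continuous_csuppZ. Qed.

Lemma sqr_normc_continuous (f : R -> R[i]) : continuous_csupp f ->
  continuous (fun x => normc (f x) ^+ 2).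
Proof.
move=> [fRe fIm _].
under [X in continuous X]eq_fun do rewrite sqr_normcE !expr2.
by move=> x; apply: cvgD; apply: cvgM; by [exact: fRe|exact: fIm].
Qed.

Lemma shift_gram_gt0 (v : 'rV[R[i]]_n) : v != 0 -> 0 < quadratic_form shift_gram v.
Proof.
move=> v0; rewrite shift_gram_quadratic_form ltcR.
have cF := shift_combination_csupp (v 0).
have [x Fx] : exists x, shift_combination (v 0) x != 0.
  apply: contrapT => h; move/eqP: v0; apply; apply/rowP => m; rewrite mxE.
  apply: shift_combination_independent => x.
  by apply/eqP/negPn/negP => Fx; apply: h; exists x.
have [_ _ [r' F0]] := cF.
apply: (@integral_gt0_continuous _ _ r' x).
- exact: sqr_normc_continuous.
- by move=> y /F0 ->; rewrite ComplexField.Normc.normc0 expr0n.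
- by move=> y; exact: sqr_ge0.
- rewrite expf_neq0//; apply: contra Fx => /eqP h; apply/eqP.
  exact: ComplexField.Normc.eq0_normc.
Qed.

(** With [F] the combination and [|v|] the Euclidean norm, [lambda_min * |v|^2 <= int |F|^2 <= n *
    (L2 - L1) * (L * eta)^2 * |v|^2], which contradicts the last hypothesis unless [v = 0]. *)
Lemma shift_combination_grid (v : 'rV[R[i]]_n) (L1 L2 eta : R) :
  (0 < n)%N -> 0 <= eta -> L1 <= L2 -> (forall m, L1 <= s m - r) -> (forall m, s m + r <= L2) ->
  (forall x, L1 <= x <= L2 -> exists2 y, `|x - y| <= eta & shift_combination (v 0) y = 0) ->
  n%:R * (L2 - L1) * (L * eta) ^+ 2 < lambda_min shift_gram ->
  v = 0.
Proof.
move=> n_gt0 eta0 L12 sL1 sL2 grid small.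
have [lam0 lamP] := lambda_min_spec n_gt0 shift_gram_hermitian shift_gram_gt0.
apply: contrapT => /eqP v0; have S0 := sum_normc_gt0 v0.
have := lamP v; rewrite shift_gram_quadratic_form lecR leNgt => /negP; apply.
set S := \sum_i _ in S0 *.
apply: (@le_lt_trans _ _ (n%:R * (L2 - L1) * (L * eta) ^+ 2 * S)); last by rewrite ltr_pM2r.
have cF := shift_combination_csupp (v 0).
pose I : set (measurableTypeR R) := `[L1, L2]%classic.
have iI : mu.-integrable setT (EFin \o \1_I) by exact: integrable_indic_itv.
have mI : measurable I by exact: measurable_itv.
(* Pointwise bound for the squared modulus on [[L1, L2]]: the Lipschitz bound to the nearby zero,
   then [sqr_sum_le]. *)
pose B := (L * eta) ^+ 2 * (n%:R * S).
have -> : n%:R * (L2 - L1) * (L * eta) ^+ 2 * S = \int[mu]_x (B * \1_I x).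
  rewrite RintegralZl// /Rintegral integral_indic// setIT.
  rewrite [X in fine X]lebesgue_measure_itv /= lte_fin /B.
  case: ifPn => /=; first by move=> _; ring.
  rewrite -leNgt => L21; have -> : L2 - L1 = 0 by move: L12 L21; lra.
  by rewrite !(mulr0, mul0r).
have [_ _ [r' F0]] := cF.
apply: le_Rintegral => //.
- apply: (integrable_csupp (r := r')); first exact: sqr_normc_continuous.
  by move=> y /F0 ->; rewrite ComplexField.Normc.normc0 expr0n.
- exact: eq_integrable (integrableZl measurableT B iI).
move=> x _ /=; rewrite indicE; case: (boolP (x \in I)) => [|xI].
  rewrite inE /I /= in_itv /= mulr1 => /grid [y xy Fy].
  rewrite -[shift_combination _ x]subr0 -Fy.
  apply: (@le_trans _ _ ((L * eta * \sum_m normc (v 0 m)) ^+ 2)).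
    rewrite lerXn2r ?nnegrE ?normc_ge0//.
      by rewrite mulr_ge0 ?mulr_ge0// sumr_ge0// => m _; exact: normc_ge0.
    rewrite (le_trans (shift_combination_lipschitz _ _ _))// ler_wpM2r ?ler_wpM2l//.
    by rewrite sumr_ge0// => m _; exact: normc_ge0.
  by rewrite exprMn /B ler_wpM2l ?sqr_ge0// sqr_sum_le.
(* Off [[L1, L2]] every term vanishes, since each interval [[s m - r, s m + r]] lies inside. *)
rewrite mulr0 /shift_combination big1 ?ComplexField.Normc.normc0 ?expr0n// => m _.
rewrite g_supp ?mulr0//; move: xI; rewrite notin_setE /I /= in_itv /= => /negP.
rewrite negb_and -!ltNge => h; have := sL1 m; have := sL2 m.
case/orP : h => h h1 h2.
  by rewrite -normrN (lt_le_trans _ (ler_norm _))//; move: h h1 h2; lra.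
by rewrite (lt_le_trans _ (ler_norm _))//; move: h h1 h2; lra.
Qed.

End Shifts.

(** * Recovering the coefficients from grid samples *)

(** The hypothesis says that [B] has rank [n], so [n] linearly independent rows can be picked. The
    transpose appears because coefficient vectors are rows, as in the quadratic form. *)
Lemma select_invertible_rows (F : fieldType) (m n : nat) (B : 'M[F]_(m, n)) :
  (forall v : 'rV_n, v *m B^T = 0 -> v = 0) ->
  exists2 f : 'I_n -> 'I_m, injective f & rowsub f B \in unitmx.
Proof.
move=> Binj; have Bfull : row_full B.
  by have := inj_row_free Binj; rewrite /row_full /row_free mxrank_tr.
exists (fullrankfun Bfull); first exact: fullrankfun_inj.
by rewrite -row_full_unit; apply: fullrowsub_full.
Qed.

Section Sampling.
Variable R : realType.

Lemma fsbig_range (n : nat) (T : choiceType) (k : 'I_n -> T) (V : nmodType) (F : T -> V) :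
  injective k -> \sum_(t \in range k) F t = \sum_i F (k i).
Proof.
move=> kinj.
have -> : range k = [set` [seq k i | i <- enum 'I_n]].
  apply/seteqP; split => [_ [i _ <-]|t /mapP[i _ ->]]; last by exists i.
  by apply/mapP; exists i => //; rewrite mem_enum.
rewrite -fsbig_seq; last by rewrite map_inj_uniq ?enum_uniq.
by rewrite big_map big_enum.
Qed.

Lemma direction_unit (p : R * R) : directions p -> p.1 ^+ 2 + p.2 ^+ 2 = 1.
Proof. by move=> [t _ ->]; exact: cos2Dsin2. Qed.

Lemma int_point_inj : injective (int_point R).
Proof. by move=> [a b] [c d] [/intr_inj -> /intr_inj ->]. Qed.

(** If [p] took equal values at distinct [k] and [l], it would be orthogonal to the nonzero
    difference [k - l], hence a null vector; being a unit vector, it is its own direction. *)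
Lemma dot2_separates (E : set (int * int)) (p : R * R) (k l : int * int) :
  (@directions R `\` direction_vectors (null_vectors (@differences R E))) p ->
  E k -> E l -> dot2 p (int_point R k) = dot2 p (int_point R l) -> k = l.
Proof.
move=> [dp ndv] Ek El kl; apply: contrapT => /eqP neq; apply: ndv.
have p1 := direction_unit dp; case: dp => t _ pt.
have p_neq0 : p != 0.
  apply/eqP => p0; move: p1; rewrite p0 /= expr0n addr0 => /eqP.
  by rewrite eq_sym oner_eq0.
exists t; split => //; exists p; split => //; last first.
  by rewrite /norm2 p1 sqrtr1 scale1r.
split => //; exists (int_point R k - int_point R l); split.
- by exists k, l; split.
- by rewrite subr_eq0; apply: contra neq => /eqP/int_point_inj ->.
- by move: kl; rewrite /dot2 /= => h; lra.
Qed.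

(** * Radon transforms of integer translates *)

Section Translate.
Variables (phi : R * R -> R[i]) (N1 M1 N2 M2 : R) (p : R * R).
Hypotheses (C1phi : C1_complex phi) (phi_box : supp phi `<=` box N1 M1 N2 M2).
Hypotheses (phi_hat : fourier2 phi (0, 0) != 0) (p_unit : p.1 ^+ 2 + p.2 ^+ 2 = 1).

Let line t s := phi (t * p.1 - s * p.2, t * p.2 + s * p.1).

Lemma line_csupp t : continuous_csupp (line t).
Proof.
have cline (u : R * R -> R) : continuous u ->
    continuous (fun s : R => u (t * p.1 - s * p.2, t * p.2 + s * p.1)).
  move=> cu; apply: continuous_comp_pair => // s.
  - by apply: cvgB; [exact: cvg_cst|apply: cvgM; [exact: cvg_id|exact: cvg_cst]].
  - by apply: cvgD; [exact: cvg_cst|apply: cvgM; [exact: cvg_id|exact: cvg_cst]].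
have [cRe cIm] := phi_re_im C1phi phi_box phi_hat.
split; [exact: cline cRe|exact: cline cIm|].
exists (Num.sqrt 2 * max_bound N1 M1 N2 M2) => s rs.
have vRe : vanishes_off (max_bound N1 M1 N2 M2) (fun x => complex.Re (phi x)).
  by apply: (phi_vanishes phi_box) => x ->.
have vIm : vanishes_off (max_bound N1 M1 N2 M2) (fun x => complex.Im (phi x)).
  by apply: (phi_vanishes phi_box) => x ->.
apply/eqP; rewrite eq_complex; apply/andP; split; apply/eqP.
- by apply: (vanishes_off_rotation p_unit vRe); rewrite rs orbT.
- by apply: (vanishes_off_rotation p_unit vIm); rewrite rs orbT.
Qed.

(** The coordinate of [k] along [(- p.2, p.1)], the direction of the lines of integration. *)
Let perp (k : int * int) : R := k.2%:~R * p.1 - k.1%:~R * p.2.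

Let translate_line k t s :
  translate phi k (t * p.1 - s * p.2, t * p.2 + s * p.1) =
  line (t - dot2 p (int_point R k)) (s - perp k).
Proof.
rewrite /translate /line; congr phi; rewrite /int_point /dot2 /perp /=.
have e2 : p.2 ^+ 2 = 1 - p.1 ^+ 2 by rewrite -p_unit addrAC subrr add0r.
congr pair => /=.
- rewrite [RHS](_ : _ = t * p.1 - s * p.2 - k.1%:~R * (p.1 ^+ 2 + p.2 ^+ 2)); last by ring.
  by rewrite p_unit mulr1.
- rewrite [RHS](_ : _ = t * p.2 + s * p.1 - k.2%:~R * (p.1 ^+ 2 + p.2 ^+ 2)); last by ring.
  by rewrite p_unit mulr1.
Qed.

(** Translation by [k] moves the line parameter [t] by [p k] and the position [s] on the line by
    [perp k]; translation invariance of the integral absorbs the latter. *)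
Lemma radon_combination (n : nat) (k : 'I_n -> int * int) (c : 'I_n -> R[i]) t :
  radon p (fun x => \sum_m c m * translate phi (k m) x) t =
  \sum_m c m * radon p phi (t - dot2 p (int_point R (k m))).
Proof.
pose l m s := line (t - dot2 p (int_point R (k m))) (s - perp (k m)).
have cl m : continuous_csupp (l m) by exact/continuous_csupp_shift/line_csupp.
rewrite /radon; under eq_fun do under eq_bigr do rewrite translate_line.
rewrite (@Cintegral_sum _ _ _ (fun m s => c m * l m s)); last by move=> m; exact: continuous_csuppZ.
apply: eq_bigr => m _; rewrite CintegralZ//; congr (_ * _).
have [cRe cIm _] := line_csupp (t - dot2 p (int_point R (k m))).
have [iRe iIm] := continuous_csupp_integrable (cl m).
apply/esym/eqP; rewrite eq_complex /=; apply/andP; split; apply/eqP.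
- rewrite (@integral_affine _ _ 1 (- perp (k m))) ?oner_eq0//.
  + rewrite normr1 mul1r; apply: eq_Rintegral => s _.
    by rewrite /l /line mul1r.
  + exact: continuous_measurable_fun cRe.
  + by apply: eq_integrable iRe => // s _ /=; rewrite /l /line mul1r.
- rewrite (@integral_affine _ _ 1 (- perp (k m))) ?oner_eq0//.
  + rewrite normr1 mul1r; apply: eq_Rintegral => s _.
    by rewrite /l /line mul1r.
  + exact: continuous_measurable_fun cIm.
  + by apply: eq_integrable iIm => // s _ /=; rewrite /l /line mul1r.
Qed.

End Translate.

End Sampling.

(** * The uniform grid and the conclusion *)

Lemma uniform_grid_near (R : realType) (L1 L2 : R) (K : nat) (x : R) :
  (0 < K)%N -> L1 < L2 -> L1 <= x <= L2 ->
  exists j : 'I_K.+1, `|x - (L1 + (L2 - L1) / K%:R * j%:R)| <= (L2 - L1) / K%:R.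
Proof.
move=> K0 L12 /andP[x1 x2].
have KR : 0 < K%:R :> R by rewrite ltr0n.
set h := (L2 - L1) / K%:R.
have h0 : 0 < h by rewrite divr_gt0// subr_gt0.
have hK : h * K%:R = L2 - L1 by rewrite /h divfK// gt_eqF.
(* The number of whole steps from [L1] to [x]; the grid point with this index is the last one not
   beyond [x]. *)
pose q := Num.truncn ((x - L1) / h).
have u0 : 0 <= (x - L1) / h by rewrite divr_ge0 ?subr_ge0// ltW.
have /andP[q1 q2] := Num.Theory.truncn_itv u0.
have qK : (q < K.+1)%N.
  rewrite ltnS -(ler_nat R) (le_trans q1)// ler_pdivrMr// mulrC hK; lra.
exists (Ordinal qK) => /=; rewrite -/q in q1 q2 *.
move: q1 q2; rewrite ler_pdivlMr// ltr_pdivrMr// -natr1 => q1 q2.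
rewrite ler_norml; apply/andP; split; nra.
Qed.

Theorem theorem4p4 (R : realType) (phi f : R * R -> R[i])
    (N1 M1 N2 M2 a1 b1 a2 b2 : R) (E : set (int * int))
    (n : nat) (k : 'I_n -> int * int) (p : R * R) :
  C1_complex phi ->
  compact (supp phi) ->
  supp phi `<=` box N1 M1 N2 M2 ->
  fourier2 phi (0, 0) != 0 ->
  shifts_linearly_independent phi ->
  E = index_set a1 b1 a2 b2 N1 M1 N2 M2 ->
  E !=set0 ->
  injective k -> range k = E ->
  shift_space phi f ->
  supp f `<=` box a1 b1 a2 b2 ->
  shift_span phi E f ->
  (@directions R `\` direction_vectors (null_vectors (@differences R E))) p ->
  exists x : 'I_n -> R,
    [/\ injective x,
        forall j, sample_grid phi N1 M1 N2 M2 p E k (x j),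
        sample_matrix phi p k x \in unitmx &
        determined_by_radon phi E p (range x) f].
Proof.
move=> C1phi _ phi_box phi_hat _ _ E0 k_inj kE _ _ f_span p_dir.
have p_unit : p.1 ^+ 2 + p.2 ^+ 2 = 1 by apply: direction_unit; case: p_dir.
pose s m := dot2 p (int_point R (k m)).
have Ek m : E (k m) by rewrite -kE; exists m.
have s_inj : injective s.
  by move=> m m' /(dot2_separates p_dir (Ek m) (Ek m'))/k_inj.
have n_gt0 : (0 < n)%N.
  by case: E0 => e; rewrite -kE => -[m _ _]; exact: leq_ltn_trans (ltn_ord m).
set M := max_bound N1 M1 N2 M2.
pose S := sup_norm (box N1 M1 N2 M2) (Cderive (1, 0) phi) +
          sup_norm (box N1 M1 N2 M2) (Cderive (0, 1) phi).
have [M_gt0 S_gt0] : 0 < M /\ 0 < S :=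
  radon_lipschitz_gt0 C1phi phi_box phi_hat p_unit.
pose g := radon p phi.
have g_lip : forall x y, normc (g x - g y) <= 2 * Num.sqrt 2 * M * S * `|x - y| :=
  radon_lipschitz C1phi phi_box phi_hat p_unit.
have g_supp : forall x, Num.sqrt 2 * M < `|x| -> g x = 0 :=
  @radon_supp _ _ _ _ _ _ _ phi_box p_unit.
have g_neq0 : exists t, g t != 0 := radon_neq0 C1phi phi_box phi_hat p_unit.
have gramE : gram phi p k = shift_gram g s by [].
have [lam_gt0 _] := lambda_min_spec n_gt0 (shift_gram_hermitian s g_lip g_supp)
  (shift_gram_gt0 g_lip g_supp g_neq0 s_inj).
set L1 := L_lower N1 M1 N2 M2 p E; set L2 := L_upper N1 M1 N2 M2 p E.
have sE : [set dot2 p (int_point R e) | e in E] = range s.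
  rewrite -kE; apply/seteqP; split => [_ [_ [m _ <-] <-]|_ [m _ <-]]; first by exists m.
  by exists (k m) => //; exists m.
have s_bound m : `|s m| <= \sum_i `|s i|.
  by rewrite (bigD1 m)//= lerDl sumr_ge0.
have L1_le m : L1 <= s m - Num.sqrt 2 * M.
  rewrite /L1 /L_lower -/M sE mulNr addrC lerD2r; apply: ge_inf; last by exists m.
  by exists (- \sum_i `|s i|) => _ [i _ <-]; have := s_bound i; rewrite ler_norml => /andP[].
have L2_ge m : s m + Num.sqrt 2 * M <= L2.
  rewrite /L2 /L_upper -/M sE [leRHS]addrC lerD2r; apply: ub_le_sup; last by exists m.
  by exists (\sum_i `|s i|) => _ [i _ <-]; have := s_bound i; rewrite ler_norml => /andP[].
have L12 : L1 < L2.
  have r_gt0 : 0 < Num.sqrt 2 * M by rewrite mulr_gt0// sqrtr_gt0.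
  by have := L1_le (Ordinal n_gt0); have := L2_ge (Ordinal n_gt0); lra.
have nR : 0 < n%:R :> R by rewrite ltr0n.
pose lam := lambda_min (shift_gram g s).
pose dlt := delta phi N1 M1 N2 M2 p E k.
have dltE : dlt = Num.sqrt (lam / (3 * n%:R * (L2 - L1))) / (2 * S * M) by [].
have q_gt0 : 0 < lam / (3 * n%:R * (L2 - L1)).
  by rewrite divr_gt0// !mulr_gt0// subr_gt0.
have dlt_gt0 : 0 < dlt by rewrite dltE divr_gt0 ?sqrtr_gt0// !mulr_gt0.
pose G := grid_size phi N1 M1 N2 M2 p E k.
have G_gt0 : 0 < G by rewrite Num.Theory.ceil_gt0 divr_gt0// subr_gt0.
pose K := `|G|%N.
have KG : K%:Z = G by rewrite gez0_abs// ltW.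
have KE : G%:~R = K%:R :> R by rewrite -KG -pmulrn.
have K_step : (L2 - L1) / dlt <= K%:R by rewrite -KE; exact: Num.Theory.ceil_ge.
have K_gt0 : (0 < K)%N.
  by rewrite -(ltr_nat R) (lt_le_trans _ K_step)// divr_gt0// subr_gt0.
have KR : 0 < K%:R :> R by rewrite ltr0n.
have step_le : (L2 - L1) / K%:R <= dlt.
  by rewrite ler_pdivrMr// mulrC -ler_pdivrMr.
(* The sample grid, with indices counted from 0. *)
pose y (j : 'I_K.+1) := L1 + (L2 - L1) / K%:R * j%:R.
have y_inj : injective y.
  move=> i j /addrI/(mulfI _) => /(_ _)/eqP; rewrite eqr_nat => h; apply/val_inj/eqP/h.
  by rewrite mulf_neq0 ?invr_neq0 ?gt_eqF// subr_gt0.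
pose B : 'M[R[i]]_(K.+1, n) := \matrix_(j, m) g (y j - s m).
have [x_ x_inj x_unit] : exists2 x_ : 'I_n -> 'I_K.+1, injective x_ & rowsub x_ B \in unitmx.
  (* A kernel vector is a combination of shifts that vanishes at every grid point, and every point
     of [[L1, L2]] is within [dlt] of the grid. *)
  apply: select_invertible_rows => v vB.
  apply: (shift_combination_grid g_lip g_supp g_neq0 s_inj
    (L1 := L1) (L2 := L2) (eta := dlt)) => //.
  - exact: ltW.
  - exact: ltW.
  - move=> x /(uniform_grid_near K_gt0 L12)[j xj]; exists (y j).
      exact: le_trans step_le.
    move/rowP/(_ j) : vB; rewrite !mxE => vB.
    by rewrite -[RHS]vB; apply: eq_bigr => m _; rewrite !mxE.
  (* The denominator of [dlt] cancels the Lipschitz constant up to [sqrt 2]. After squaring, the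
     bound is [2/3] of [lam], the 3 in [delta] leaving room for strictness. *)
  - have -> : 2 * Num.sqrt 2 * M * S * dlt = Num.sqrt 2 * Num.sqrt (lam / (3 * n%:R * (L2 - L1))).
      by rewrite dltE; field; rewrite !gt_eqF.
    rewrite exprMn !sqr_sqrtr ?(ltW q_gt0)//.
    rewrite (_ : _ * _ = lam * (2 / 3)); last first.
      by field; rewrite !gt_eqF// subr_gt0.
    by rewrite -/lam gtr_pMr// ltr_pdivrMr// mul1r ltr_nat.
exists (y \o x_); split.
- exact: inj_comp.
(* The index shifts by one because [sample_grid] counts from 1. *)
- move=> j; exists ((x_ j)%:Z + 1).
    by rewrite /= -/G -KG lerDr lerD2r !lez_nat -(ltnS (x_ j)) ltn_ord.
  by rewrite /= addrK /y -/G -KE pmulrn.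
- by rewrite (_ : sample_matrix _ _ _ _ = rowsub x_ B)//; apply/matrixP => j m; rewrite !mxE.
split=> // h h_span hf.
have spanE u : shift_span phi E u -> exists c : 'cV[R[i]]_n,
    u = (fun x => \sum_m c m 0 * translate phi (k m) x).
  move=> [c uE]; exists (\col_m c (k m)); apply/funext => x.
  by rewrite uE -kE fsbig_range//; apply: eq_bigr => m _; rewrite mxE.
have [c fE] := spanE _ f_span; have [d hE] := spanE _ h_span.
suff -> : h = f by [].
rewrite fE hE; suff -> : d = c by [].
(* The sample matrix sends the coefficients to the Radon samples, so by invertibility equal samples
   give equal coefficients. *)
have sampleE (e : 'cV[R[i]]_n) : rowsub x_ B *m e = \col_j
    radon p (fun x => \sum_m e m 0 * translate phi (k m) x) (y (x_ j)).
  apply/colP => j; rewrite !mxE (radon_combination C1phi phi_box phi_hat p_unit).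
  by apply: eq_bigr => m _; rewrite !mxE mulrC.
rewrite -[d](mulKmx x_unit) -[c](mulKmx x_unit) !sampleE; congr (_ *m _).
by apply/colP => j; rewrite !mxE -fE -hE; apply: hf; exists j.
Qed.
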